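(* Let $n,k$ be integers with $1\le k\le 2n$. The number of lozenge tilings of a $(k,2n+1-k,k,k+1,2n-k,k+1)$ hexagon without the central triangle is $$\frac{(n-q)(n-q+1)^5\cdots n^{4q+1}(n+1)^{4q+1}\cdots(n+q+1)}{2^{(2q)(2q+1)}\,3^{8(q-1)+2}\,5^{8(q-2)+2}\cdots(2q+1)^2} =\frac{\prod_{j=0}^{q}\bigl((n-j)(n+1+j)\bigr)^{4(q-j)+1}}{2^{2q(2q+1)}\prod_{j=1}^{q}(2j+1)^{8(q-j)+2}}$$ if $k=2q+1$, and $$\frac{(n-q+1)^3\cdots n^{4q-1}(n+1)^{4q-1}\cdots(n+q)^3}{2^{(2q-1)(2q)}\,3^{8(q-1)-2}\,5^{8(q-2)-2}\cdots(2q-1)^6} =\frac{\prod_{j=0}^{q-1}\bigl((n-j)(n+1+j)\bigr)^{4(q-j)-1}}{2^{(2q-1)2q}\prod_{j=1}^{q-1}(2j+1)^{8(q-j)-2}}$$ if $k=2q$.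
   Context: An $(a,b,c,d,e,f)$ hexagon is a hexagon with all angles equal to $120$ degrees and side lengths $a,b,c,d,e,f$ in clockwise order, drawn so that the side of length $b$ is the (horizontal) top side and the side of length $e$ is the bottom side; it is subdivided into equilateral triangles of unit side by lines parallel to the sides (sides of length $0$ are allowed). A lozenge is a rhombus with unit sides and angles $120$ and $60$ degrees, i.e. the union of two unit triangles sharing an edge; a tiling of a region is a partition of its unit triangles into lozenges. In the $(k,2n+1-k,k,k+1,2n-k,k+1)$ hexagon the horizontal line joining the leftmost and rightmost vertices has length $2n+1$ and is made of $2n+1$ unit edges of the triangulation; the central triangle is the (downward-pointing) unit triangle lying directly below the middle unit edge of this line. (For $k=n$ this is the central triangle of the $(n,n+1,n,n+1,n,n+1)$ hexagon.) *)

(* Defs.v *)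
From mathcomp Require Import all_boot all_order all_algebra.

Set Implicit Arguments.
Unset Strict Implicit.
Unset Printing Implicit Defensive.

(* Lattice points are pairs (x, y) standing for x u + y v, where u is the
   horizontal unit vector and v is u rotated by +60 degrees.  Two lattice points
   are joined by a unit edge when they differ by +-u, +-v or +-(v - u). *)
Definition point := (nat * nat)%type.

(* The unit triangles of the w u by h v parallelogram cornered at the origin.
   Each unit rhombus with lower left corner (x, y) is cut by its edge from
   (x + 1, y) to (x, y + 1) into an upward triangle (false) and a downward
   triangle (true). *)
Definition triangle (w h : nat) := ('I_w * 'I_h * bool)%type.

Definition up_corners (x y : nat) : seq point :=
  [:: (x, y); (x.+1, y); (x, y.+1)].

Definition down_corners (x y : nat) : seq point :=
  [:: (x, y.+1); (x.+1, y.+1); (x.+1, y)].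

Definition corners (w h : nat) (t : triangle w h) : seq point :=
  let: (x, y, down) := t in if down then down_corners x y else up_corners x y.

Definition share_edge (w h : nat) (s t : triangle w h) : bool :=
  count (mem (corners t)) (corners s) == 2.

Definition lozenge (w h : nat) (L : {set triangle w h}) : bool :=
  [exists s, exists t, share_edge s t && (L == [set s; t])].

Definition tilings (w h : nat) (D : {set triangle w h}) :
    {set {set {set triangle w h}}} :=
  [set P | partition P D & [forall L in P, lozenge L]].

(* Sides a, ..., f are listed clockwise, b being the top side.  The hexagon
   closes up when a + f = c + d and b + c = e + f; its vertices, clockwise from
   the leftmost one, are then
     (0, f), (0, a + f), (b, a + f), (b + c, d), (e + f, 0), (f, 0),
   and it is the part of the (b + c) u by (a + f) v parallelogram lying between
   the lines x + y = f (the side f) and x + y = d + e + f (the side c). *)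
Definition hexagon (a b c d e f : nat) : {set triangle (b + c) (a + f)} :=
  [set t | all (fun p : point => f <= p.1 + p.2 <= d + e + f) (corners t)].

(* The leftmost and rightmost vertices of the hexagon below are (0, k + 1) and
   (2 n + 1, k + 1), so the middle unit edge between them runs from (n, k + 1)
   to (n + 1, k + 1), and the downward triangle below it is the one removed. *)
Definition holed_hexagon (n k : nat) :
    {set triangle ((2 * n + 1 - k) + k) (k + (k + 1))} :=
  [set t in hexagon k (2 * n + 1 - k) k (k + 1) (2 * n - k) (k + 1)
     | corners t != down_corners n k].

(* Main.v *)
Require Import Defs.
From mathcomp Require Import all_boot all_order all_algebra all_fingroup.
From mathcomp Require Import zify ring.
Import Order.TTheory GRing.Theory Num.Theory.

Set Implicit Arguments.
Unset Strict Implicit.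
Unset Printing Implicit Defensive.

(** Cut the hexagon along the horizontal line through its leftmost and rightmost
vertices.  A tiling is determined by the set X of unit edges of this line that
are crossed by a lozenge, together with a tiling of the upper trapezoid minus the
upward triangles above X and a tiling of the lower trapezoid minus the downward
triangles below X and minus the hole ([card_tilings_cut]).  Counting triangles of
both orientations forces X to have k elements, and X avoids the middle edge n.

A trapezoid whose long side has dents at s_0 < ... < s_(r-1), r being its height,
has det C(s_i, j) tilings ([num_tilings_trapezoid]), which is the Vandermonde
product of the s_i divided by 0! 1! ... (r-1)!.  This goes by peeling off one row
at a time: the tilings of a row correspond to the sets that interlace the dents,
and summing a determinant over an interlacing set gives a determinant of the same
kind with one more row.  The lower trapezoid, turned upside down, has its dents at
the reflection of X and n, so the number N of tilings satisfies
  N * (0! ... (k-1)!) * (0! ... k!) = sum over X of V(X)^2 prod_(x in X) |x - n|,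
where V(X) is the Vandermonde product of X.

By Andreief's identity ([andreief]) the right-hand side is the determinant of the
matrix with entries sum_y |y| P_i(y) Q_j(y), y running from -n to n, for any
two sequences of monic polynomials P_i and Q_j of degrees i and j
([card_tilings_det]).  With P_i and Q_j of the parity of their degree the matrix
is a checkerboard, and its determinant is the product of those of its even and its
odd halves ([det_checkerboard]).  The choice
  P = prod_l (y^2 - l^2)  and  Q = prod_l (y^2 - (n + l)^2),  times y in odd degree,
makes every entry a product ([momentE]), as the entries satisfy a recurrence
that comes from the difference of two successive factors of P and Q.  Up to
factors depending on one index only, the entries are ratios of rising factorials
with i and j shifted, a determinant that is found by induction on its size
([det_ratio]).  Hence both determinants are products of explicit numbers
([moment_norm], the squared norms of the monic polynomials orthogonal for
the factor |y|), and the product formulas follow by comparing the quotients of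
consecutive values ([odd_formula_rec], [even_formula_rec]). *)

(** * Perfect matchings of a finite graph *)

Section Matchings.
Variables (V : finType) (e : rel V).
Hypothesis e_sym : symmetric e.
Hypothesis e_irr : irreflexive e.

Definition pairing (L : {set V}) : bool :=
  [exists s, exists t, e s t && (L == [set s; t])].

Definition matchings (D : {set V}) : {set {set {set V}}} :=
  [set P | partition P D & [forall L in P, pairing L]].

(** A perfect matching seen as the involution that sends each vertex to its partner.
Gluing and restricting functions is simpler than doing so with set partitions. *)
Definition is_mate_function (D : {set V}) (f : {ffun V -> V}) : bool :=
  [forall v, if v \in D then [&& f v \in D, e v (f v) & f (f v) == v]
             else f v == v].

Definition mate_functions (D : {set V}) : {set {ffun V -> V}} := [set f | is_mate_function D f].

Lemma mate_functionsP (D : {set V}) (f : {ffun V -> V}) :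
  reflect ((forall v, v \in D -> [/\ f v \in D, e v (f v) & f (f v) = v])
           /\ (forall v, v \notin D -> f v = v)) (f \in mate_functions D).
Proof.
rewrite inE; apply: (iffP forallP) => [H|[H1 H2] v].
- split=> v vD; move: (H v); first by rewrite vD => /and3P[? ? /eqP].
  by rewrite (negPf vD) => /eqP.
case: ifPn => [/H1 [-> -> ->]|/H2 ->]; by rewrite ?eqxx.
Qed.

Definition blocks (D : {set V}) (f : {ffun V -> V}) : {set {set V}} :=
  [set [set v; f v] | v in D].

Lemma card_matchings (D : {set V}) : #|matchings D| = #|mate_functions D|.
Proof.
have inj : {in mate_functions D &, injective (blocks D)}.
  move=> f g /mate_functionsP[f1 f2] /mate_functionsP[g1 g2] E; apply/ffunP => v.
  have [vD|vD] := boolP (v \in D); last by rewrite f2 // g2.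
  have : [set v; f v] \in blocks D g by rewrite -E; apply: imset_f.
  case/imsetP => u uD /setP S.
  have [_ ev _] := f1 v vD.
  have nv : f v != v by apply: contraTneq ev => ->; rewrite e_irr.
  have [_ _ gg] := g1 u uD.
  move: (S (f v)) (S v); rewrite !inE !eqxx orbT orTb.
  move=> /esym /orP [/eqP|/eqP] F /esym /orP [/eqP|/eqP] F'.
  - by move: nv; rewrite F F' eqxx.
  - by rewrite F F' gg.
  - by rewrite F F'.
  - by move: nv; rewrite F F' eqxx.
rewrite -(card_in_imset inj); congr #|pred_of_set _|; apply/setP => P.
apply/idP/imsetP => [|[f /mate_functionsP[f1 f2] ->]].
- rewrite inE => /andP[/and3P[/eqP cov tr n0] /forallP all].
  have blk v : v \in D -> exists u, [/\ u \in D, e v u & [set v; u] \in P].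
    rewrite -cov => /bigcupP[L LP vL].
    have := all L; rewrite LP => /existsP[s /existsP[t /andP[est /eqP EL]]].
    have uD u : u \in L -> u \in cover P by move=> uL; apply/bigcupP; exists L.
    move: vL; rewrite EL !inE => /orP[/eqP->|/eqP->].
      exists t; split => //; first by apply: uD; rewrite EL !inE eqxx orbT.
      by rewrite -EL.
    exists s; split => //; [by apply: uD; rewrite EL !inE eqxx | by rewrite e_sym
       | by rewrite setUC -EL].
  have uniqb v u u' : [set v; u] \in P -> [set v; u'] \in P -> e v u -> e v u' -> u = u'.
    move=> p1 p2 e1 e2; move/trivIsetP: tr => /(_ _ _ p1 p2).
    have [/setP E _|_ /(_ isT)] := eqVneq [set v; u] [set v; u'].
      move: (E u); rewrite !inE eqxx orbT => /esym/orP[/eqP E'|/eqP //].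
      by move: e1; rewrite E' e_irr.
    move=> /pred0P /(_ v); rewrite /= !inE eqxx //.
  pose m v := odflt v [pick u | e v u && ([set v; u] \in P)].
  have mP v : v \in D -> e v (m v) /\ [set v; m v] \in P.
    move=> /blk[u [uD evu vu]]; rewrite /m; case: pickP => [z /andP[]//|/(_ u)].
    by rewrite evu vu.
  have mD v : v \in D -> m v \in D.
    by move=> /mP[_ bP]; rewrite -cov; apply/bigcupP; exists [set v; m v] => //;
      rewrite !inE eqxx orbT.
  have mm v : v \in D -> m (m v) = v.
    move=> vD; have [e1 p1] := mP v vD; have [e2 p2] := mP _ (mD v vD).
    apply: uniqb p2 _ e2 _; [by rewrite setUC | by rewrite e_sym].
  have m0 v : v \notin D -> m v = v.
    move=> vD; rewrite /m; case: pickP => // u /andP[_ vP]; case/negP: vD.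
    by rewrite -cov; apply/bigcupP; exists [set v; u] => //; rewrite !inE eqxx.
  exists (finfun m).
    apply/mate_functionsP; split => v vD; rewrite !ffunE; last exact: m0.
    by split; [exact: mD | by case: (mP v vD) | rewrite mm].
  apply/setP => L; apply/idP/imsetP => [LP|[v vD ->]]; last first.
    by rewrite ffunE; case: (mP v vD).
  have := all L; rewrite LP => /existsP[s /existsP[t /andP[est /eqP EL]]].
  have sD : s \in D by rewrite -cov; apply/bigcupP; exists L => //; rewrite EL !inE eqxx.
  exists s => //; rewrite ffunE EL; congr [set _; _].
  have [e1 p1] := mP s sD; apply: (uniqb s) => //; by rewrite -EL.
- rewrite inE; apply/andP; split.
  apply/and3P; split.
  + apply/eqP/setP => v; apply/bigcupP/idP => [[L /imsetP[u uD ->]]|vD].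
      by case: (f1 u uD) => fD _ _; rewrite !inE => /orP[]/eqP->.
    by exists [set v; f v]; [apply: imset_f | rewrite !inE eqxx].
  + apply/trivIsetP => _ _ /imsetP[u uD ->] /imsetP[v vD ->].
    have [_ _ fu] := f1 u uD; have [_ _ fv] := f1 v vD.
    apply: contraNT => /pred0Pn[z /andP[]]; rewrite !inE.
    move=> /orP[]/eqP-> /orP[]/eqP E; apply/eqP.
    * by rewrite E.
    * by rewrite E fv setUC.
    * by rewrite -E fu setUC.
    * by move: (congr1 f E); rewrite fu fv => ->.
  + by apply/imsetP => -[u uD /setP/(_ u)]; rewrite !inE eqxx.
  apply/forallP => L; apply/implyP => /imsetP[v vD ->].
  have [_ ev _] := f1 v vD.
  by apply/existsP; exists v; apply/existsP; exists (f v); rewrite ev eqxx.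
Qed.

Lemma card_matchings0 : #|matchings set0| = 1.
Proof.
rewrite card_matchings -(cards1 (finfun id : {ffun V -> V})).
congr #|pred_of_set _|; apply/setP => f; rewrite [RHS]inE; apply/mate_functionsP/eqP => [[_ H]|->].
  by apply/ffunP => v; rewrite ffunE H // inE.
by split=> v; rewrite ?inE // ffunE.
Qed.

Lemma card_matchings_isolated (D : {set V}) v :
  v \in D -> (forall u, u \in D -> ~~ e v u) -> #|matchings D| = 0.
Proof.
move=> vD H; rewrite card_matchings; apply: eq_card0 => f.
apply/negP => /mate_functionsP[/(_ v vD)[fD ev _] _].
by move: (H _ fD); rewrite ev.
Qed.

(** The pairs of a matching of A and B that join A to B form a set X of crossing edges.
Since crossing edges are disjoint from each other, X can be any set of them, and the
rest of the matching is a matching of what X leaves of A, and another one for B. *)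
Lemma card_matchings_cut (I : finType) (A B : {set V}) (a b : I -> V) (J : {set I}) :
  [disjoint A & B] ->
  {in J &, injective a} -> {in J &, injective b} ->
  (forall i, i \in J -> [/\ a i \in A, b i \in B & e (a i) (b i)]) ->
  (forall u v, u \in A -> v \in B -> e u v -> exists2 i, i \in J & u = a i /\ v = b i) ->
  #|matchings (A :|: B)| =
    \sum_(X : {set I} | X \subset J)
       #|matchings (A :\: a @: X)| * #|matchings (B :\: b @: X)|.
Proof.
move=> dAB ainj binj JP cross.
have BA v : v \in B -> v \in A = false by move=> vB; rewrite (disjointFl dAB).
have AB v : v \in A -> v \in B = false by move=> vB; rewrite (disjointFr dAB).
pose tr (f : {ffun V -> V}) := [set i in J | f (a i) == b i].
rewrite card_matchings -sum1_card (partition_big tr (fun X => X \subset J)) /=; last first.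
  by move=> f _; apply/subsetP => i; rewrite inE => /andP[].
apply: eq_bigr => X /subsetP XJ.
rewrite !card_matchings -cardsX.
pose A' := A :\: a @: X; pose B' := B :\: b @: X.
pose res (f : {ffun V -> V}) : {ffun V -> V} * {ffun V -> V} :=
  ([ffun v => if v \in A' then f v else v], [ffun v => if v \in B' then f v else v]).
have aX i : i \in J -> (a i \in a @: X) = (i \in X).
  move=> iJ; apply/imsetP/idP => [[j jX /ainj E]|iX]; last by exists i.
  by rewrite E // XJ.
have bX i : i \in J -> (b i \in b @: X) = (i \in X).
  move=> iJ; apply/imsetP/idP => [[j jX /binj E]|iX]; last by exists i.
  by rewrite E // XJ.
rewrite sum1dep_card.
(* A partner outside A' or B' would be reached by a crossing edge, whose index is then in X. *)
have key f : f \in mate_functions (A :|: B) -> tr f = X ->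
   (forall i, i \in X -> f (a i) = b i /\ f (b i) = a i) /\
   (forall v, v \in A' -> f v \in A') /\ (forall v, v \in B' -> f v \in B').
  move=> /mate_functionsP[f1 f2] trX.
  have onX i : i \in X -> f (a i) = b i /\ f (b i) = a i.
    move=> iX; have := iX; rewrite -trX inE => /andP[iJ /eqP E]; split => //.
    have [aA _ _] := JP i iJ.
    by have [|_ _ <-] := f1 (a i); rewrite ?inE ?aA // E.
  split=> //; split => v; rewrite !inE => /andP[nX vin].
  + have [|] := f1 v; first by rewrite inE vin.
    rewrite inE => /orP[fA|fB] ev ff.
      rewrite fA andbT; apply: contra nX => /imsetP[i iX E]; have [E1 E2] := onX i iX.
      by move: vin; rewrite -ff E E1 BA //; case: (JP i (XJ i iX)).
    have [i iJ [E1 E2]] := cross _ _ vin fB ev.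
    have iX : i \in X by rewrite -trX inE iJ -E1 -E2 eqxx.
    by case/negP: nX; rewrite E1 aX.
  + have [|] := f1 v; first by rewrite inE vin orbT.
    rewrite inE => /orP[fA|fB] ev ff; last first.
      rewrite fB andbT; apply: contra nX => /imsetP[i iX E]; have [E1 E2] := onX i iX.
      by move: vin; rewrite -ff E E2 AB //; case: (JP i (XJ i iX)).
    rewrite e_sym in ev.
    have [i iJ [E1 E2]] := cross _ _ fA vin ev.
    have iX : i \in X by rewrite -trX inE iJ -E2 -E1 -{2}ff eqxx.
    by case/negP: nX; rewrite E2 bX.
rewrite -(card_in_imset (f := res) (D := [set f in mate_functions (A :|: B) | tr f == X]));
  last first.
  move=> f g; rewrite inE => /andP[fm /eqP fX]; rewrite inE => /andP[gm /eqP gX].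
  move=> /pair_equal_spec[E1 E2].
  have [fab _] := key f fm fX; have [gab _] := key g gm gX.
  apply/ffunP => v; move/ffunP/(_ v): E1; move/ffunP/(_ v): E2; rewrite !ffunE.
  have [//|nB _] := boolP (v \in B'); have [//|nA _] := boolP (v \in A').
  have [/imsetP[i iX ->]|na] := boolP (v \in a @: X).
    by case: (fab i iX) => -> _; case: (gab i iX).
  have [/imsetP[i iX ->]|nb] := boolP (v \in b @: X).
    by case: (fab i iX) => _ ->; case: (gab i iX).
  move: nA nB; rewrite !inE na nb /= => nA nB.
  move/mate_functionsP: fm => [_ ->]; last by rewrite inE negb_or nA.
  by move/mate_functionsP: gm => [_ ->] //; rewrite inE negb_or nA.
rewrite -/A' -/B'; congr #|pred_of_set _|; apply/setP => -[f g]; rewrite in_setX.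
apply/imsetP/andP => [[h]|[/mate_functionsP[/= f1 f2] /mate_functionsP[/= g1 g2]]].
  rewrite inE => /andP[hm /eqP hX] [-> ->].
  have [hab [hA hB]] := key h hm hX; move/mate_functionsP: hm => [h1 h2].
  split; apply/mate_functionsP; split => v vin; rewrite ?ffunE ?(negPf vin) ?vin //.
  + rewrite hA //; have /setDP[vA _] := vin.
    by have [|_ -> ->] := h1 v; rewrite ?inE ?vA.
  + rewrite hB //; have /setDP[vA _] := vin.
    by have [|_ -> ->] := h1 v; rewrite ?inE ?vA ?orbT.
(* The inverse of res glues f and g along sw, which swaps the ends of the edges of X. *)
pose sw v := if [pick i in X | v == a i] is Some i then b i else
             if [pick i in X | v == b i] is Some i then a i else v.
have swa i : i \in X -> sw (a i) = b i.
  move=> iX; rewrite /sw; case: pickP => [j /andP[jX /eqP/ainj]|/(_ i)].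
    by move=> -> //; exact: XJ.
  by rewrite /= iX eqxx.
have swb i : i \in X -> sw (b i) = a i.
  move=> iX; rewrite /sw; case: pickP => [j /andP[jX /eqP E]|_].
    have [_ bB _] := JP i (XJ i iX); have [aA _ _] := JP j (XJ j jX).
    by move: (BA _ bB); rewrite E aA.
  case: pickP => [j /andP[jX /eqP/binj]|/(_ i)].
    by move=> -> //; exact: XJ.
  by rewrite /= iX eqxx.
pose h := [ffun v => if v \in A' then f v else if v \in B' then g v else sw v].
have B'A' v : v \in B' -> v \in A' = false.
  by rewrite !inE => /andP[_ /BA ->]; rewrite andbF.
have hfA v : v \in A' -> h v = f v by move=> vA; rewrite ffunE vA.
have hgB v : v \in B' -> h v = g v by move=> vA; rewrite ffunE vA B'A'.
have haX i : i \in X -> h (a i) = b i.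
  move=> iX; rewrite ffunE !inE aX ?XJ // iX /= AB ?andbF ?swa //.
  by case: (JP i (XJ i iX)).
have hbX i : i \in X -> h (b i) = a i.
  move=> iX; rewrite ffunE !inE bX ?XJ // iX /= BA ?andbF ?swb //.
  by case: (JP i (XJ i iX)).
have hm : h \in mate_functions (A :|: B).
  apply/mate_functionsP; split => v; last first.
    rewrite inE negb_or => /andP[nA nB]; rewrite ffunE !inE (negPf nA) (negPf nB) !andbF.
    rewrite /sw; case: pickP => [i /andP[iX /eqP E]|_].
      by move: nA; rewrite E; case: (JP i (XJ i iX)) => ->.
    case: pickP => [i /andP[iX /eqP E]|//].
    by move: nB; rewrite E; case: (JP i (XJ i iX)) => _ ->.
  move=> vAB.
  have [vA|nA] := boolP (v \in A').
    have [fA' ev ff] := f1 v vA; rewrite !hfA //; split => //.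
    by move: fA'; rewrite !inE => /andP[_ ->].
  have [vB|nB] := boolP (v \in B').
    have [fA' ev ff] := g1 v vB; rewrite !hgB //; split => //.
    by move: fA'; rewrite !inE => /andP[_ ->]; rewrite orbT.
  move: vAB nA nB; rewrite !inE => /orP[vA|vB].
    rewrite vA andbT negbK => /imsetP[i iX ->] _; rewrite haX // hbX //.
    by case: (JP i (XJ i iX)) => aA bB ->; split; rewrite // bB orbT.
  move=> _; rewrite vB andbT negbK => /imsetP[i iX ->]; rewrite hbX // haX //.
  by case: (JP i (XJ i iX)) => aA bB; rewrite e_sym => ->; split; rewrite // aA.
exists h.
  rewrite inE hm; apply/eqP/setP => i; rewrite inE.
  have [iX|niX] := boolP (i \in X); first by rewrite haX // XJ // eqxx.
  have [iJ /=|//] := boolP (i \in J); apply/negbTE/eqP => E.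
  have aA' : a i \in A' by rewrite !inE aX // niX; case: (JP i iJ).
  rewrite hfA // in E; have [] := f1 _ aA'; rewrite E inE => /andP[_].
  by case: (JP i iJ) => _ /BA ->.
rewrite /res; congr pair; apply/ffunP => v; rewrite [RHS]ffunE.
  by case: ifPn => [/hfA|/f2].
by case: ifPn => [/hgB|/g2].
Qed.

(** A cut that separates v from the rest is crossed only by the edge from v to u. *)
Lemma card_matchings_leaf (D : {set V}) u v :
  v \in D -> u \in D -> e v u -> (forall z, z \in D -> e v z -> z = u) ->
  #|matchings D| = #|matchings (D :\ v :\ u)|.
Proof.
move=> vD uD evu H.
have nvu : v != u by apply: contraTneq evu => ->; rewrite e_irr.
rewrite -{1}(setD1K vD).
rewrite (card_matchings_cut (a := id) (b := fun=> u) (J := [set v])).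
- rewrite (bigD1 [set v]) ?subxx //= big1 ?addn0 => [|X /andP[Xv Xn]].
    rewrite !imset_set1 setDv card_matchings0 mul1n.
    by congr #|pred_of_set (matchings _)|; apply/setP => z; rewrite !inE.
  have -> : X = set0 by move: Xv; rewrite subset1 (negPf Xn) => /eqP.
  rewrite !imset0 setD0 (card_matchings_isolated (v := v)) ?inE // => z.
  by rewrite inE => /eqP->; rewrite e_irr.
- by rewrite disjoint_sym disjoints_subset; apply/subsetP => z; rewrite !inE => /andP[].
- by [].
- by move=> i j; rewrite !inE => /eqP-> /eqP->.
- by move=> i /set1P ->; rewrite !inE eqxx eq_sym nvu.
- move=> z t /set1P-> /setD1P[_ tD] evt; exists v; rewrite ?inE //.
  by split => //; exact: H.
Qed.

Lemma card_matchings_aut (phi : V -> V) (D : {set V}) :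
  involutive phi -> (forall u v, e (phi u) (phi v) = e u v) ->
  #|matchings (phi @^-1: D)| = #|matchings D|.
Proof.
move=> phiK ephi; rewrite !card_matchings.
pose c (f : {ffun V -> V}) := [ffun v => phi (f (phi v))].
have cK : involutive c by move=> f; apply/ffunP => v; rewrite !ffunE !phiK.
rewrite -[RHS](card_imset _ (inv_inj cK)); congr #|pred_of_set _|; apply/setP => f.
rewrite -[f]cK (mem_imset _ _ (inv_inj cK)).
move: (c f) => g {f}.
have E v : c g v = phi (g (phi v)) by rewrite ffunE.
apply/mate_functionsP/mate_functionsP => -[g1 g2]; split => v vD.
- have := g1 (phi v); rewrite inE phiK => /(_ vD); rewrite inE !E !phiK => -[? h1 h2].
  by split; rewrite // -1?ephi // -[LHS]phiK h2 phiK.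
- by have := g2 (phi v); rewrite inE phiK => /(_ vD); rewrite E phiK => /(can_inj phiK).
- rewrite inE in vD; have [? h1 h2] := g1 _ vD; rewrite inE !E !phiK; split => //.
    by rewrite -ephi phiK.
  by rewrite h2 phiK.
- by rewrite inE in vD; rewrite E (g2 _ vD) phiK.
Qed.

End Matchings.

(** * Tilings as matchings of unit triangles *)

Definition adjacent (ux uy dx dy : nat) : bool :=
  [|| (dx == ux) && (dy == uy), (dx.+1 == ux) && (dy == uy)
    | (dx == ux) && (dy.+1 == uy)].

(** In the skew coordinates the upward triangle of a cell shares its slanted edge with
the downward triangle of the same cell, its left edge with that of the cell on the
left, and its bottom edge with that of the cell below. *)
Lemma share_edgeE w h (x x' : 'I_w) (y y' : 'I_h) (b b' : bool) :
  share_edge (x, y, b) (x', y', b') =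
    (b != b') && (if b then adjacent x' y' x y else adjacent x y x' y').
Proof.
rewrite /share_edge /adjacent /corners.
move: (nat_of_ord x) (nat_of_ord y) (nat_of_ord x') (nat_of_ord y').
move=> {w h x y x' y'} x y x' y'.
have cmp3 (m n : nat) : [\/ [/\ (m == n) = true, (m.+1 == n) = false & (m == n.+1) = false],
   [/\ (m == n) = false, (m.+1 == n) = true & (m == n.+1) = false],
   [/\ (m == n) = false, (m.+1 == n) = false & (m == n.+1) = true] |
   [/\ (m == n) = false, (m.+1 == n) = false & (m == n.+1) = false]].
  case: (m =P n) => [e0|n0]; first by apply: Or41; split => //; lia.
  case: (m.+1 =P n) => [e1|n1]; first by apply: Or42; split => //; lia.
  by case: (m =P n.+1) => e2; [apply: Or43 | apply: Or44].
have sx (m n : nat) : (m == n) = (n == m) by rewrite eq_sym.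
case: b; case: b' => /=; rewrite !inE !xpair_eqE !eqSS.
all: rewrite ?(sx x' x) ?(sx x'.+1 x) ?(sx x' x.+1) ?(sx y' y) ?(sx y'.+1 y) ?(sx y' y.+1).
all: case: (cmp3 x x') => -[-> -> ->]; case: (cmp3 y y') => -[-> -> ->] //=.
Qed.

Lemma share_edge_sym w h : symmetric (@share_edge w h).
Proof.
move=> [[x y] b] [[x' y'] b']; rewrite !share_edgeE [b' == b]eq_sym.
by case: b b' => [] [].
Qed.

Lemma share_edge_irr w h : irreflexive (@share_edge w h).
Proof. by move=> [[x y] b]; rewrite share_edgeE eqxx. Qed.

Lemma tilingsE w h (D : {set triangle w h}) : tilings D = matchings (@share_edge w h) D.
Proof. by []. Qed.

(** Regions are given by predicates on natural coordinates, so that arithmetic applies to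
them directly; the flag is true for downward triangles. *)
Definition region w h (P : nat -> nat -> bool -> bool) : {set triangle w h} :=
  [set t : triangle w h | P t.1.1 t.1.2 t.2].

Lemma eq_region w h P Q :
  (forall x y b, x < w -> y < h -> P x y b = Q x y b) -> region w h P = region w h Q.
Proof. by move=> H; apply/setP => -[[x y] b]; rewrite !inE /= H. Qed.

Definition num_tilings w h P := #|matchings (@share_edge w h) (region w h P)|.

Lemma eq_num_tilings w h P Q :
  (forall x y b, x < w -> y < h -> P x y b = Q x y b) -> num_tilings w h P = num_tilings w h Q.
Proof. by move=> H; rewrite /num_tilings (eq_region H). Qed.

(** The relation of [share_edgeE] on natural coordinates. *)
Definition neighbours x y b x' y' b' :=
    (b != b') && (if b then adjacent x' y' x y else adjacent x y x' y').

Lemma num_tilings_isolated w h (P : nat -> nat -> bool -> bool) x y b :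
  x < w -> y < h -> P x y b ->
  (forall x' y' b', P x' y' b' -> x' < w -> y' < h -> ~~ neighbours x y b x' y' b') ->
  num_tilings w h P = 0.
Proof.
move=> xw yh Pxy H.
apply: (card_matchings_isolated (@share_edge_sym w h) (@share_edge_irr w h) (v := (Ordinal xw,
  Ordinal yh, b))) => [|[[x' y'] b']].
  by rewrite inE.
by rewrite inE /= share_edgeE => PP; apply: H.
Qed.

Lemma num_tilings_leaf w h (P : nat -> nat -> bool -> bool) x y b x' y' b' :
  x < w -> y < h -> x' < w -> y' < h -> P x y b -> P x' y' b' -> neighbours x y b x' y' b' ->
  (forall z t c, P z t c -> z < w -> t < h -> neighbours x y b z t c -> [/\ z = x', t =
    y' & c = b']) ->
  num_tilings w h P = num_tilings w h (fun z t c => [&& P z t c, ~~ [&& z == x, t == y & c == b]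
         & ~~ [&& z == x', t == y' & c == b']]).
Proof.
move=> xw yh x'w y'h Pv Pu adj H.
rewrite /num_tilings.
rewrite (card_matchings_leaf (@share_edge_sym w h) (@share_edge_irr w h)
  (v := (Ordinal xw, Ordinal yh, b)) (u := (Ordinal x'w, Ordinal y'h, b'))) ?inE //.
- congr #|pred_of_set (matchings _ _)|; apply/setP => -[[z t] c];
  rewrite !inE /= !xpair_eqE -!val_eqE /= !andbA.
  by rewrite andbC andbA [RHS]andbAC.
- by rewrite share_edgeE.
- move=> [[z t] c]; rewrite inE /= share_edgeE => PP /H []// E1 E2 ->.
  by congr (_, _, _); apply: val_inj.
Qed.

(** * A single row of triangles *)

(** The condition s_0 <= x_0 < s_1 <= x_1 < ... < s_r, with s one element longer than x:
see [interlacedP].  The default 0 of head makes the test fail when s runs out. *)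
Fixpoint interlaced (s x : seq nat) : bool :=
  match s, x with
  | [:: _], [::] => true
  | a :: s', b :: x' => (a <= b) && (b < head 0 s') && interlaced s' x'
  | _, _ => false
  end.

(** What is left of a row when it is matched from left to right up to position p; when pend
holds, the downward triangle at p - 1 still awaits its partner. *)
Definition row_cells (y0 m p : nat) (pend : bool) (s x : seq nat) : nat -> nat -> bool -> bool :=
  fun i y b => (y == y0) &&
    (if b then ((p <= i) && (i < m) && (i \notin x)) || (pend && (i.+1 == p))
     else [&& p <= i, i <= m & i \notin s]).

(** The condition under which [row_cells] has a matching: a pending downward triangle
means that one more element of s than of x has been met, so x is next to move. *)
Definition row_tilable (pend : bool) (s x : seq nat) : bool :=
  if pend then (if x is b :: x' then (b < head 0 s) && interlaced s x' else s == [::])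
  else interlaced s x.

Lemma num_tilings_empty w h P : (forall x y b, x < w -> y < h -> ~~ P x y b) ->
  num_tilings w h P = 1.
Proof.
move=> H; rewrite /num_tilings (_ : region w h P = set0).
  by rewrite card_matchings0 //; [apply: share_edge_sym | apply: share_edge_irr].
by apply/setP => -[[x y] b]; rewrite !inE /= (negPf (H _ _ _ _ _)).
Qed.

Lemma sorted_from p q l : sorted ltn l -> all (fun i => p <= i < q) l ->
  (p \notin l /\ all (fun i => p.+1 <= i < q) l) \/
  (exists l', [/\ l = p :: l', p \notin l', sorted ltn l' & all (fun i => p.+1 <= i < q) l']).
Proof.
case: l => [|a l] sl al; first by left.
have min := order_path_min ltn_trans sl.
case/andP: al => /andP[pa aq] al.
have gtl : all (fun i => p.+1 <= i < q) l.
  apply/allP => i il; move/allP/(_ i il): min; move/allP/(_ i il): al => /=; lia.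
have pl : p \notin l by apply/negP => /(allP gtl) /=; rewrite ltnn.
move: pa; rewrite leq_eqVlt => /orP[/eqP<-|pa].
  by right; exists l; split => //; exact: path_sorted sl.
by left; rewrite inE negb_or pl /= pa aq gtl neq_ltn pa.
Qed.

(** Membership tests are turned into boolean variables, which keeps the arithmetic small. *)
Ltac cell_lia :=
  repeat match goal with
  | H : is_true (all _ _) |- _ => clear H
  | H : is_true (sorted _ _) |- _ => clear H
  | H : forall _, _ |- _ => clear H
  end;
  repeat match goal with H : context [in_mem _ _] |- _ => revert H end;
  rewrite ?/row_cells ?/neighbours ?/adjacent ?inE /=;
  repeat match goal with |- context [in_mem ?a ?l] => generalize (in_mem a l) end;
  intros; lia.

(** Both sides describe the same cells, up to the treatment of position p. *)
Ltac row_step p :=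
  apply: eq_num_tilings; let i := fresh "i" in intro i;
  case: (eqVneq i p) => [->|?] ? [] ? ?; cell_lia.

(** The triangles of a row form a path, so matching it from the left never leaves a choice:
the leftmost triangle has one neighbour, or none.  Hence there is at most one tiling,
and following the forced moves reads off the interlacing condition. *)
Lemma num_tilings_row w h y0 m p pend s x : y0 < h -> m < w -> p <= m ->
  sorted ltn s -> sorted ltn x ->
  all (fun i => p <= i < m.+1) s -> all (fun i => p <= i < m) x ->
  (pend ==> (0 < p)) ->
  num_tilings w h (row_cells y0 m p pend s x) = row_tilable pend s x.
Proof.
move=> yh mw.
have [d] := ubnP (m - p); elim: d p pend s x => // d IH p pend s x dm pm ss sx sb xb pp.
have nilP q l : all (fun i => q.+1 <= i < q.+1) l -> l = [::].
  by case: l => // a l /=; lia.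
have nilP' q l : all (fun i => q <= i < q) l -> l = [::].
  by case: l => // a l /=; lia.
have headS l : all (fun i => p.+1 <= i < m.+1) l -> (p < head 0 l) = (l != [::]).
  by case: l => //= a l /andP[/andP[]].
(* At p = m the upward triangle at m and the pending triangle are all that can be left. *)
have := pm; rewrite leq_eqVlt => /orP[/eqP E|ltpm].
  subst p; have xn := nilP' _ _ xb; subst x.
  case: (sorted_from ss sb) => [[ps /nilP ->]|[l [El _ _ /nilP El']]].
    case: pend pp => [/= m0|_].
      rewrite (num_tilings_leaf (x := m.-1) (y := y0) (b := true) (x' := m) (y' := y0) (b' :=
        false)) //.
      * rewrite num_tilings_empty // => i y b iw yh'; rewrite /row_cells; case: b; lia.
      * lia.
      * rewrite /row_cells /=; lia.
      * rewrite /row_cells /=; lia.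
      * rewrite /neighbours /adjacent /=; lia.
      * move=> z t c; rewrite /row_cells /neighbours /adjacent; case: c => //= A1 A2 A3 A4;
        split=> //; lia.
    rewrite (num_tilings_isolated (x := m) (y := y0) (b := false)) //.
    * rewrite /row_cells /=; lia.
    * move=> z t c; rewrite /row_cells /neighbours /adjacent; case: c => //=; lia.
  rewrite {l}El' in El; rewrite El.
  case: pend pp => [/= m0|_].
    rewrite (num_tilings_isolated (x := m.-1) (y := y0) (b := true)) //.
    * lia.
    * rewrite /row_cells /=; lia.
    * move=> z t c; rewrite /row_cells /neighbours /adjacent inE; case: c => //=; lia.
  rewrite num_tilings_empty // => i y b iw yh'; rewrite /row_cells inE; case: b; lia.
have IH' pend' s' x' : sorted ltn s' -> sorted ltn x' ->
  all (fun i => p.+1 <= i < m.+1) s' -> all (fun i => p.+1 <= i < m) x' ->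
  num_tilings w h (row_cells y0 m p.+1 pend' s' x') = row_tilable pend' s' x'.
  by move=> *; apply: IH => //; lia.
(* Eight cases: p is in s or not, p is in x or not, a triangle is pending or not. *)
case: (sorted_from ss sb) => [[ps sb']|[s' [Es ps' ss' sb']]];
case: (sorted_from sx xb) => [[px xb']|[x' [Ex px' sx' xb']]]; case: pend pp => [/= p0|_].
- rewrite (num_tilings_leaf (x := p.-1) (y := y0) (b := true) (x' := p) (y' := y0) (b' :=
  false)) //; try cell_lia.
  * by rewrite -[RHS](IH' true) //; row_step p.
  * move=> z t c; rewrite /row_cells /neighbours /adjacent; case: c => //= A1 A2 A3 A4;
    split=> //; cell_lia.
- rewrite (num_tilings_leaf (x := p) (y := y0) (b := false) (x' := p) (y' := y0) (b' := true))
  //; try cell_lia.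
  * by rewrite -[RHS](IH' false) //; row_step p.
  * move=> z t c; rewrite /row_cells /neighbours /adjacent; case: c => //= A1 A2 A3 A4;
    split=> //; cell_lia.
- rewrite (num_tilings_leaf (x := p.-1) (y := y0) (b := true) (x' := p) (y' := y0) (b' :=
  false)) //; try cell_lia.
  * rewrite Ex /= (headS s) //.
    have -> : (s != [::]) && interlaced s x' = row_tilable false s x' by case: (s).
    by rewrite -(IH' false) //; row_step p.
  * move=> z t c; rewrite /row_cells /neighbours /adjacent; case: c => //= A1 A2 A3 A4;
    split=> //; cell_lia.
- rewrite (num_tilings_isolated (x := p) (y := y0) (b := false)) //; try cell_lia.
  * rewrite Ex /=; case: (s) sb' => //= a s' /andP[/andP[pa _] _].
    by case: s' => * /=; rewrite leqNgt pa.
  * rewrite Ex; move=> z t c; rewrite /row_cells /neighbours /adjacent inE; case: c => //=;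
    cell_lia.
- rewrite (num_tilings_isolated (x := p.-1) (y := y0) (b := true)) //; try cell_lia.
  * rewrite Es; case: (x) xb' => [|b x''] //= /andP[/andP[pb _] _].
    by case: (s') => * /=; rewrite ltnNge (ltnW pb).
  * rewrite Es; move=> z t c; rewrite /row_cells /neighbours /adjacent inE; case: c => //=;
    cell_lia.
- rewrite Es -[row_tilable _ _ _]/(interlaced (p :: s') x).
  have -> : interlaced (p :: s') x = row_tilable true s' x.
    case: (x) xb' => [_|b x''] /=; first by case: (s').
    by move=> /andP[/andP[pb _] _]; case: (s') => *; rewrite (ltnW pb).
  by rewrite -(IH' true) //; row_step p.
- rewrite (num_tilings_isolated (x := p.-1) (y := y0) (b := true)) //; try cell_lia.
  * by rewrite Es Ex /= ltnn.
  * rewrite Es; move=> z t c; rewrite /row_cells /neighbours /adjacent inE; case: c => //=;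
    cell_lia.
- rewrite Es Ex; have -> : row_tilable false (p :: s') (p :: x') =
  (p < head 0 s') && interlaced s' x'.
    by rewrite /=; case: (s') => *; rewrite leqnn.
  rewrite headS //=.
  have -> : (s' != [::]) && interlaced s' x' = row_tilable false s' x' by case: (s').
  by rewrite -(IH' false) //; row_step p.
Qed.

(** * Trapezoids, row by row *)

(** The elements in increasing order, since enumerations of ordinals are increasing. *)
Definition values w (X : {set 'I_w}) : seq nat := [seq val i | i <- enum X].

Lemma mem_values w (X : {set 'I_w}) (i : 'I_w) : (val i \in values X) = (i \in X).
Proof. by rewrite (mem_map val_inj) mem_enum. Qed.

Lemma values_sorted w (X : {set 'I_w}) : sorted ltn (values X).
Proof.
rewrite /values {1}/enum_mem -enumT.
have : sorted ltn (map val (enum 'I_w)) by rewrite val_enum_ord iota_ltn_sorted.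
rewrite !sorted_map; apply: subseq_sorted; last by rewrite -enumT; exact: filter_subseq.
by move=> ? ? ?; apply: ltn_trans.
Qed.

Lemma size_values w (X : {set 'I_w}) : size (values X) = #|X|.
Proof. by rewrite size_map -cardE. Qed.

Lemma all_values w (X : {set 'I_w}) (Q : pred nat) :
  all Q (values X) = [forall (i | i \in X), Q (val i)].
Proof.
rewrite all_map; apply/allP/forall_inP => H i; have := H i; rewrite mem_enum //; exact.
Qed.

(** The bottom row, at height y0, is the longest one; the positions in s are its dents. *)
Definition trapezoid (y0 c : nat) (s : seq nat) : nat -> nat -> bool -> bool :=
  fun x y b => [&& y0 <= y, x + y + b <= c & [|| y != y0, b | x \notin s]].

(** Cut along the top of the bottom row: the lozenges that cross this line leave dents X in
the row, which must interlace s, and the same dents in the bottom of the trapezoid above. *)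
Lemma num_tilings_trapezoid_step w h y0 c s : y0 < h -> y0 <= c -> c - y0 < w ->
  sorted ltn s -> all (fun i => i + y0 <= c) s ->
  num_tilings w h (trapezoid y0 c s) =
  \sum_(X : {set 'I_w} | X \subset [set x : 'I_w | (x + y0.+1 <= c) && (y0.+1 < h)])
     interlaced s (values X) * num_tilings w h (trapezoid y0.+1 c (values X)).
Proof.
move=> yh yc cw ss sc.
pose yb := insubd (Ordinal yh) y0.+1.
pose J := [set x : 'I_w | (x + y0.+1 <= c) && (y0.+1 < h)].
have ybE : y0.+1 < h -> val yb = y0.+1 by move=> H; rewrite val_insubd H.
pose A := region w h (row_cells y0 (c - y0) 0 false s [::]).
pose B := region w h (trapezoid y0.+1 c [::]).
pose a (x : 'I_w) : triangle w h := (x, Ordinal yh, true).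
pose b (x : 'I_w) : triangle w h := (x, yb, false).
have -> : num_tilings w h (trapezoid y0 c s) = #|matchings (@share_edge w h) (A :|: B)|.
  rewrite /num_tilings; congr #|pred_of_set (matchings _ _)|.
  apply/setP => -[[x y] []]; rewrite !inE /= /row_cells /trapezoid; cell_lia.
rewrite (card_matchings_cut (@share_edge_sym w h) (@share_edge_irr w h) (a := a) (b := b) (J := J)).
- apply: eq_bigr => X /subsetP XJ; congr (_ * _).
  + rewrite -[RHS]/(nat_of_bool (row_tilable false s (values X))).
    rewrite -(@num_tilings_row w h y0 (c - y0) 0) ?values_sorted //.
    * rewrite /num_tilings; congr #|pred_of_set (matchings _ _)|.
      apply/setP => -[[x y] d]; rewrite !inE /= /row_cells.
      have -> : ((x, y, d) \in a @: X) = [&& (y == y0 :> nat), d & x \in X].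
        apply/imsetP/and3P => [[z zX [-> -> ->]]|[/eqP yy dd xX]]; first by rewrite eqxx.
        by exists x => //; rewrite /a dd; congr (_, _, _); apply: val_inj.
      rewrite mem_values in_nil; case: d; case: (nat_of_ord y == y0); case: (x \in X);
        by rewrite ?andbT ?andbF ?orbF.
    * apply: sub_all sc => i; lia.
    * rewrite all_values; apply/forall_inP => i /XJ; rewrite inE /=; lia.
  + rewrite /num_tilings; congr #|pred_of_set (matchings _ _)|.
    apply/setP => -[[x y] d]; rewrite !inE /= /trapezoid.
    have -> : ((x, y, d) \in b @: X) = [&& (y == y0.+1 :> nat), ~~ d & x \in X].
      apply/imsetP/and3P => [[z zX [-> -> ->]]|[/eqP yy dd xX]].
        have := XJ _ zX; rewrite inE => /andP[_ /ybE ->].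
        by rewrite eqxx.
      exists x => //; rewrite /b (negPf dd); congr (_, _, _); apply: val_inj.
      by rewrite ybE ?yy // -yy.
    rewrite mem_values; case: d; case: (nat_of_ord y == y0.+1); case: (x \in X);
      by rewrite ?andbT ?andbF ?orbT.
- rewrite disjoints_subset; apply/subsetP => -[[x y] d].
  rewrite !inE /= /row_cells /trapezoid; case: d; cell_lia.
- by move=> x y _ _ [].
- by move=> x y _ _ [].
- move=> i; rewrite inE => /andP[ic yh1];
  rewrite !inE /= share_edgeE /row_cells /trapezoid /= !ybE //.
  split; [cell_lia|cell_lia|]. rewrite /adjacent; lia.
- move=> [[x y] d] [[x' y'] d']; rewrite !inE /= share_edgeE /row_cells /trapezoid /adjacent =>
  H1 H2 H3.
  have [E1 E2 E3 E4 E5] : [/\ d, d' = false, x = x' :> nat, y = y0 :> nat & y' = y0.+1 :> nat].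
    by move: H1 H2 H3; case: d; case: d' => //=; split => //; lia.
  have yh1 : y0.+1 < h by rewrite -E5.
  exists x; first by rewrite inE; move: H2; rewrite E2 E5 E3 /=; lia.
  rewrite /a /b E1 E2; split; congr (_, _, _); apply: val_inj => //.
  by rewrite ybE.
Qed.

Lemma interlacedP s x :
  reflect (size s = (size x).+1 /\
           forall i, i < size x -> nth 0 s i <= nth 0 x i < nth 0 s i.+1)
          (interlaced s x).
Proof.
elim: x s => [|b x IH] [|a s] /=; try by constructor => -[].
- case: s => [|? ?]; constructor; first by [].
  by case.
have -> : match s with | [::] | _ => (a <= b < head 0 s) && interlaced s x end
    = (a <= b < head 0 s) && interlaced s x by case: s.
apply: (iffP andP) => [[ab /IH[ss H]]|[[ss] H]].
  split; first by rewrite ss.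
  case=> [_|i] /=; last exact: H.
  by rewrite nth0.
split; first by have := H 0 isT; rewrite /= nth0.
by apply/IH; split => // i ix; exact: (H i.+1).
Qed.

Lemma nth_values w (X : {set 'I_w}) (x0 : 'I_w) i : i < #|X| ->
  nth 0 (values X) i = nth x0 (enum X) i.
Proof. by move=> iX; rewrite (nth_map x0) // -cardE. Qed.

Lemma values_imset w r (f : 'I_r -> 'I_w) :
  (forall i j : 'I_r, i < j -> f i < f j) ->
  values [set f i | i in 'I_r] = [seq val (f i) | i <- enum 'I_r].
Proof.
move=> mono; apply: (irr_sorted_eq ltn_trans ltnn).
- exact: values_sorted.
- have : sorted ltn (map val (enum 'I_r)) by rewrite val_enum_ord iota_ltn_sorted.
  by rewrite !sorted_map; apply: sub_sorted => i j; apply: mono.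
- move=> i; apply/mapP/mapP => [[j]|[j _ ->]].
    by rewrite mem_enum => /imsetP[l _ ->] ->; exists l; rewrite ?mem_enum.
  by exists (f j) => //; rewrite mem_enum; apply: imset_f.
Qed.

(** * Cutting the hexagon into two trapezoids *)

Lemma mem_holed_hexagon n k (x : 'I_(2 * n + 1 - k + k)) (y : 'I_(k + (k + 1))) b :
  k <= 2 * n ->
  ((x, y, b) \in holed_hexagon n k) =
  (k < x + y + b) && (x + y + b <= 2 * n + k + 1) &&
  ~~ [&& x == n :> nat, y == k :> nat & b].
Proof.
move=> kn; rewrite !inE; congr (_ && _).
  by case: b => /=; rewrite ?andbT; lia.
congr (~~ _); rewrite /corners; case: b.
  rewrite andbT /down_corners !eqseq_cons andbT !xpair_eqE !eqSS.
  by case: (nat_of_ord x == n); case: (nat_of_ord y == k).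
rewrite !andbF /up_corners /down_corners !eqseq_cons !xpair_eqE.
apply/negbTE/negP => /and4P[/andP[/eqP -> _] /andP[_ /eqP ->] /andP[/eqP H _] _]; lia.
Qed.

(** The symmetry that makes the lower trapezoid stand on its long side, like the upper one. *)
Definition half_turn w h (t : triangle w h) : triangle w h :=
  (rev_ord t.1.1, rev_ord t.1.2, ~~ t.2).

Lemma half_turnK w h : involutive (@half_turn w h).
Proof. by move=> [[x y] b]; rewrite /half_turn /= !rev_ordK negbK. Qed.

Lemma share_edge_half_turn w h (s t : triangle w h) :
  share_edge (half_turn s) (half_turn t) = share_edge s t.
Proof.
case: s t => [[x y] b] [[x' y'] b']; rewrite /half_turn !share_edgeE /= /adjacent.
have := ltn_ord x; have := ltn_ord y; have := ltn_ord x'; have := ltn_ord y'.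
move: (nat_of_ord x) (nat_of_ord y) (nat_of_ord x') (nat_of_ord y') => {x y x' y'} x y x' y' *.
case: b; case: b' => //=; congr [|| _ && _, _ && _ | _ && _]; lia.
Qed.

(** The crossing edges are at all positions but n0, whose lower triangle is the hole.  After
the half turn the hole is one more dent of the lower trapezoid. *)
Lemma card_tilings_cut n k : 0 < k -> k <= 2 * n ->
  forall n0 : 'I_(2 * n + 1 - k + k), n0 = n :> nat ->
  #|tilings (holed_hexagon n k)| =
  \sum_(X : {set 'I_(2 * n + 1 - k + k)} | X \subset ~: [set n0])
    num_tilings (2 * n + 1 - k + k) (k + (k + 1)) (trapezoid k.+1 (2 * n + k + 1) (values X)) *
    num_tilings (2 * n + 1 - k + k) (k + (k + 1))
       (trapezoid k (2 * n + k) (values (@rev_ord _ @^-1: (n0 |: X)))).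
Proof.
move=> k0 kn n0 n0E.
set w := 2 * n + 1 - k + k; set h := k + (k + 1).
have wE : w = (2 * n).+1 by rewrite /w; lia.
have hE : h = (2 * k).+1 by rewrite /h; lia.
have kh : k < h by rewrite hE; lia.
have kh1 : k.+1 < h by rewrite hE; lia.
rewrite tilingsE -/w -/h.
pose A := region w h (trapezoid k.+1 (2 * n + k + 1) [::]).
pose B := region w h (fun x y b => [&& y <= k, k < x + y + b & ~~ [&& x == n, y == k & b]]).
pose a (x : 'I_w) : triangle w h := (x, Ordinal kh1, false).
pose b (x : 'I_w) : triangle w h := (x, Ordinal kh, true).
have -> : holed_hexagon n k = A :|: B.
  apply/setP => -[[x y] c]; rewrite mem_holed_hexagon // !inE /= /trapezoid in_nil !orbT andbT.
  have xw : x < (2 * n).+1 by rewrite -wE.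
  have c1 : c <= 1 by case: (c).
  have [yk|yk] := leqP (nat_of_ord y) k.
    by rewrite /= (_ : x + y + c <= _) ?andbT //; lia.
  rewrite (_ : k < x + y + c) /=; last by lia.
  by rewrite (gtn_eqF yk) andbF andbT orbF.
rewrite (card_matchings_cut (@share_edge_sym w h) (@share_edge_irr w h) (a := a) (b := b) (J :=
  ~: [set n0])).
- apply: eq_bigr => X /subsetP XJ; congr (_ * _).
  + rewrite /num_tilings; congr #|pred_of_set (matchings _ _)|.
    apply/setP => -[[x y] c]; rewrite !inE /= /trapezoid.
    have -> : ((x, y, c) \in a @: X) = [&& (y == k.+1 :> nat), ~~ c & x \in X].
      apply/imsetP/and3P => [[z zX [-> -> ->]]|[/eqP yy cc xX]]; first by rewrite eqxx.
      by exists x => //; rewrite /a (negPf cc); congr (_, _, _); apply: val_inj.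
    rewrite mem_values in_nil; case: c; case: (nat_of_ord y == k.+1); case: (x \in X);
      by rewrite /= ?andbT ?andbF ?orbT.
  + rewrite /num_tilings -(card_matchings_aut (@share_edge_sym w h) (@share_edge_irr w h)
       _ (@half_turnK w h) (@share_edge_half_turn w h)).
    congr #|pred_of_set (matchings _ _)|.
    apply/setP => -[[x y] c]; rewrite !inE /= /trapezoid.
    have -> : ((rev_ord x, rev_ord y, ~~ c) \in b @: X) =
      [&& (y == k :> nat), ~~ c & rev_ord x \in X].
      have yh : y < (2 * k).+1 by rewrite -hE.
      apply/imsetP/and3P => [[z zX [-> yy cc]]|[/eqP yy cc xX]].
        by rewrite cc zX; split => //; move: yy => /=; lia.
      exists (rev_ord x) => //; rewrite /b cc; congr (_, _, _); apply: val_inj => /=.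
      lia.
    rewrite mem_values !inE -val_eqE /= n0E.
    have xw : x < (2 * n).+1 by rewrite -wE.
    have yh : y < (2 * k).+1 by rewrite -hE.
    have -> : (h - y.+1 == k) = (nat_of_ord y == k) by lia.
    have -> : (h - y.+1 <= k) = (k <= y) by lia.
    have -> : (k < w - x.+1 + (h - y.+1) + ~~ c) = (x + y + c <= 2 * n + k).
      by case: c => /=; lia.
    case: c; case: (nat_of_ord y =P k); case: (_ == n); case: (_ \in X);
      by rewrite /= ?andbT ?andbF ?orbT.
- rewrite disjoints_subset; apply/subsetP => -[[x y] c].
  by rewrite !inE /= /trapezoid => /andP[ky _]; rewrite leqNgt ky.
- by move=> x y _ _ [].
- by move=> x y _ _ [].
- move=> i; rewrite !inE => ni; rewrite /= share_edgeE /trapezoid /adjacent /=.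
  have iw : i < (2 * n).+1 by rewrite -wE.
  have ni' : (i == n :> nat) = false by rewrite -n0E; apply: negbTE.
  by rewrite ni' /=; split; lia.
- move=> [[x y] c] [[x' y'] c']; rewrite !inE /= share_edgeE /trapezoid /adjacent => H1 H2 H3.
  have [E1 E2 E3 E4 E5] : [/\ c = false, c', x = x' :> nat, y = k.+1 :> nat & y' = k :> nat].
    by move: H1 H2 H3; case: c; case: c' => //=; split => //; lia.
  exists x.
    rewrite !inE -val_eqE /= n0E; move: H2; rewrite E2 E5 E3 eqxx; lia.
  by rewrite /a /b E1 E2; split; congr (_, _, _); apply: val_inj.
Qed.

Local Open Scope ring_scope.

(** * Determinants *)

(** A determinant is linear in each row: the sum over the choices f of one term in each row
is the determinant of the row sums. *)
Lemma sum_det_rows (R : comRingType) (k : nat) (X : finType) (Q : 'I_k -> pred X)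
    (F : 'I_k -> 'I_k -> X -> R) :
  \sum_(f in family Q) \det (\matrix_(i, j) F i j (f i)) =
  \det (\matrix_(i, j) \sum_(x | Q i x) F i j x).
Proof.
rewrite exchange_big /=; apply: eq_bigr => s _; rewrite -mulr_sumr; congr (_ * _).
under [RHS]eq_bigr => i _ do rewrite mxE.
rewrite bigA_distr_big_dep; apply: eq_bigr => f _.
by apply: eq_bigr => i _; rewrite mxE.
Qed.

(** Subtracting from each row the previous one clears the first column below its top entry. *)
Lemma det_first_col1 (R : comRingType) (r : nat) (a : nat -> nat -> R) :
  (forall i, a i 0%N = 1) ->
  \det (\matrix_(i < r.+1, j < r.+1) a i j) =
  \det (\matrix_(i < r, j < r) (a i.+1 j.+1 - a i j.+1)).
Proof.
move=> a1.
pose L : 'M[R]_r.+1 := \matrix_(i, j) ((i == j)%:R - (i == j.+1 :> nat)%:R).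
have dL : \det L = 1.
  rewrite det_trig; last first.
    apply/is_trig_mxP => i j ij; rewrite mxE -val_eqE /=.
    by rewrite !(ltn_eqF (_ : i < _)%N) ?subrr // ltnW.
  rewrite big1 // => i _; rewrite mxE eqxx.
  by rewrite (ltn_eqF (ltnSn i)) subr0.
rewrite -[LHS]mul1r -dL -det_mulmx.
have LA0 j : (L *m \matrix_(i < r.+1, j < r.+1) a i j) ord0 j = a 0%N j.
  rewrite mxE (bigD1 ord0) //= big1 ?addr0 => [|i ne]; rewrite !mxE.
    by rewrite eqxx /= subr0 mul1r.
  by rewrite eq_sym (negPf ne) /= subr0 mul0r.
have LAS (i : 'I_r) j : (L *m \matrix_(i < r.+1, j < r.+1) a i j) (lift ord0 i) j
     = a i.+1 j - a i j.
  rewrite mxE.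
  under eq_bigr => l _ do rewrite !mxE mulrBl.
  rewrite sumrB; congr (_ - _).
    rewrite (bigD1 (lift ord0 i)) //= eqxx mul1r big1 ?addr0 // => l ne.
    by rewrite eq_sym (negPf ne) mul0r.
  rewrite (bigD1 (widen_ord (leqnSn r) i)) //= eqxx mul1r big1 ?addr0 // => l ne.
  rewrite eqSS; case: eqP => [E|_]; last by rewrite mul0r.
  by case/eqP: ne; apply: val_inj.
rewrite (expand_det_col _ ord0) big_ord_recl big1 ?addr0 => [|i _].
  rewrite LA0 a1 mul1r /cofactor expr0 mul1r; congr (\det _).
  by apply/matrixP => i j; rewrite mxE mxE LAS mxE.
by rewrite LAS !a1 subrr mul0r.
Qed.

(** The passage from monomials to monic polynomials of the same degrees is unitriangular. *)
Lemma det_monic_basis (R : comNzRingType) (k : nat) (p : nat -> {poly R}) (x : 'I_k -> R) :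
  (forall j, p j \is monic) -> (forall j, size (p j) = j.+1) ->
  \det (\matrix_(i < k, j < k) (p j).[x i]) =
  \prod_(i < k) \prod_(j < k | (i < j)%N) (x j - x i).
Proof.
move=> pm ps.
have := det_Vandermonde (\row_(j < k) x j).
under [RHS]eq_bigr => i _ do (under eq_bigr => j _ do rewrite !mxE).
move=> <-; rewrite -[LHS]det_tr.
set V := Vandermonde _ _; set M := _^T.
have -> : M =
   (\matrix_(j < k, l < k) (p j)`_l) *m V.
  apply/matrixP => i j; rewrite !mxE (horner_coef_wide (n := k)) ?ps //.
  by apply: eq_bigr => l _; rewrite !mxE.
rewrite det_mulmx det_trig; last first.
  apply/is_trig_mxP => i j ij; rewrite mxE nth_default // ps //.
rewrite big1 ?mul1r // => i _; rewrite mxE.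
by have /eqP := pm i; rewrite /lead_coef ps.
Qed.

(** The falling factorial of degree j as a polynomial, a monic multiple of the j-th binomial. *)
Definition falling_poly (R : comNzRingType) (j : nat) : {poly R} := \prod_(l < j) ('X - l%:R%:P).

Lemma size_falling_poly (R : comNzRingType) j : size (falling_poly R j) = j.+1.
Proof. by rewrite size_prod_XsubC -sum1_size big_const_ord iter_addn mul1n addn0. Qed.

Lemma monic_falling_poly (R : comNzRingType) j : falling_poly R j \is monic.
Proof. exact: monic_prod_XsubC. Qed.

Lemma horner_falling_poly (R : comNzRingType) j s : (falling_poly R j).[s%:R] = (s ^_ j)%:R.
Proof.
rewrite /falling_poly horner_prod; under eq_bigr => l _ do rewrite hornerXsubC.
elim: j => [|j IH]; first by rewrite big_ord0 ffactn0.
rewrite big_ord_recr /= IH ffactnSr natrM.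
have [js|js] := leqP j s; first by rewrite natrB.
by rewrite ffact_small // !mul0r.
Qed.

Lemma det_binomial (k : nat) (s : 'I_k -> nat) :
  \det (\matrix_(i < k, j < k) ('C(s i, j))%:R) * \prod_(j < k) (j`!)%:R =
  \prod_(i < k) \prod_(j < k | (i < j)%N) ((s j)%:R - (s i)%:R) :> rat.
Proof.
rewrite -(det_monic_basis (fun i => (s i)%:R) (@monic_falling_poly rat) (@size_falling_poly rat)).
have -> : \prod_(j < k) (j`!)%:R = \det (diag_mx (\row_(j < k) (j`!)%:R)) :> rat.
  by rewrite det_diag; apply: eq_bigr => j _; rewrite mxE.
rewrite -det_mulmx; congr (\det _); apply/matrixP => i j.
rewrite mul_mx_diag !mxE horner_falling_poly -natrM; by rewrite bin_ffact.
Qed.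

(** Listing the even indices before the odd ones, among rows and columns alike, makes the
matrix block diagonal; both reorderings have the same sign. *)
Lemma det_checkerboard (R : comRingType) (m1 m2 : nat) (C : bool -> nat -> nat -> R) :
  (m2 <= m1 <= m2.+1)%N ->
  \det (\matrix_(i < m1 + m2, j < m1 + m2)
     if odd i == odd j then C (odd i) i./2 j./2 else 0) =
  \det (\matrix_(i < m1, j < m1) C false i j) * \det (\matrix_(i < m2, j < m2) C true i j).
Proof.
move=> m12.
(* The permutation s lists the even indices, then the odd ones. *)
have sP (i : 'I_(m1 + m2)) :
    ((if i < m1 then i.*2 else (i - m1).*2.+1) < m1 + m2)%N.
  by have := ltn_ord i; case: ifP; lia.
pose s0 (i : 'I_(m1 + m2)) := Ordinal (sP i).
have s_inj : injective s0.
  move=> i j /(congr1 val) /= E; apply: val_inj => /=; move: E.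
  by case: ifP => ?; case: ifP => ? ?; lia.
pose s := perm s_inj.
set A := \matrix_(i, j) _.
have <- : \det (row_perm s (col_perm s A)) = \det A.
  rewrite row_permE col_permE !det_mulmx !det_perm odd_permV mulrCA -signr_addb addbb.
  by rewrite mulr1.
rewrite -(det_ublock _ 0); congr (\det _); apply/matrixP => i j.
rewrite !mxE !permE /s0 /=; case: splitP => i' Ei; rewrite !mxE; case: splitP => j' Ej;
  rewrite !mxE Ei Ej.
- by rewrite !odd_double eqxx !doubleK.
- by rewrite /= !odd_double.
- by rewrite /= !odd_double.
- by rewrite /= !odd_double !addKn !uphalf_double.
Qed.

(** * Trapezoids as binomial determinants *)

(** The sets that interlace s have r elements, and choosing such a set is choosing its i-th
element in the interval from s_i to s_(i+1), independently for each i.  G is given the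
increasing enumeration of the set. *)
Lemma sum_interlaced (R : ringType) w r (s : seq nat) (J : {set 'I_w}) (G : (nat -> nat) -> R) :
  (0 < w)%N -> sorted ltn s -> size s = r.+1 ->
  (forall g g', (forall i, (i < r)%N -> g i = g' i) -> G g = G g') ->
  (forall (i : 'I_r) (x : 'I_w), (x < nth 0 s i.+1)%N -> x \in J) ->
  \sum_(X : {set 'I_w} | X \subset J) (interlaced s (values X))%:R * G (nth 0%N (values X)) =
  \sum_(f in family (fun (i : 'I_r) (x : 'I_w) => nth 0 s i <= x < nth 0 s i.+1)%N)
     G (fun i => nth 0%N [seq val (f i) | i <- enum 'I_r] i).
Proof.
move=> w0 ss szs Gext HJ.
pose x0 := Ordinal w0.
pose h (f : {ffun 'I_r -> 'I_w}) := [set f i | i in 'I_r].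
pose h' (X : {set 'I_w}) : {ffun 'I_r -> 'I_w} := [ffun i : 'I_r => nth x0 (enum X) i].
rewrite (bigID (fun X => interlaced s (values X))) /= [X in _ + X]big1 ?addr0; last first.
  by move=> X /andP[_ /negPf ->]; rewrite mul0r.
have hK X : interlaced s (values X) -> h (h' X) = X.
  move=> /interlacedP[sz _]; have cX : #|X| = r.
    by move: sz; rewrite szs size_values => -[].
  apply/setP => x; apply/imsetP/idP => [[i _ ->]|xX].
    by rewrite ffunE -mem_enum mem_nth // -cardE cX ltn_ord.
  have lt : (index x (enum X) < r)%N by rewrite -cX cardE index_mem mem_enum.
  by exists (Ordinal lt) => //; rewrite ffunE /= nth_index // mem_enum.
rewrite (reindex_onto h h') /=; last by move=> X /andP[_]; apply: hK.
have famP (f : {ffun 'I_r -> 'I_w}) :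
   reflect (forall i : 'I_r, nth 0 s i <= f i < nth 0 s i.+1)%N
     (f \in family (fun (i : 'I_r) (x : 'I_w) => nth 0 s i <= x < nth 0 s i.+1)%N).
  by apply: (iffP idP) => [/familyP H i|H]; [exact: H | apply/familyP => i; exact: H].
have mono (f : {ffun 'I_r -> 'I_w}) :
   f \in family (fun (i : 'I_r) (x : 'I_w) => nth 0 s i <= x < nth 0 s i.+1)%N ->
   forall i j : 'I_r, (i < j)%N -> (f i < f j)%N.
  move=> /famP H i j ij; have /andP[Hj _] := H j; have /andP[_ Hi] := H i.
  apply: leq_trans Hi _; apply: leq_trans Hj.
  move: ij; rewrite leq_eqVlt => /orP[/eqP -> //|ij].
  rewrite ltnW // (sorted_ltn_nth ltn_trans) // inE szs //; have := ltn_ord j; lia.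
apply: eq_big => [f|f].
  apply/idP/idP => [/andP[/andP[_ /interlacedP[sz H]] /eqP <-]|fF].
    apply/famP => i; rewrite ffunE.
    have cX : #|h f| = r by move: sz; rewrite szs size_values => -[].
    by rewrite -nth_values ?cX // H // size_values cX.
  have vE := values_imset (mono _ fF).
  have szh : size (values (h f)) = r by rewrite vE size_map size_enum_ord.
  have nE i (ir : (i < r)%N) : nth 0%N (values (h f)) i = f (Ordinal ir).
    by rewrite vE (nth_map (Ordinal ir)) ?size_enum_ord // (nth_ord_enum _ (Ordinal ir)).
  apply/andP; split; first (apply/andP; split).
  - apply/subsetP => x /imsetP[i _ ->]; apply: (HJ i).
    by move/famP: fF => /(_ i) /andP[_].
  - apply/interlacedP; split; first by rewrite szh.
    rewrite szh => i ir; rewrite nE.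
    by move/famP: fF => /(_ (Ordinal ir)).
  - apply/eqP/ffunP => i; rewrite ffunE; apply: val_inj => /=.
    rewrite -nth_values -?size_values ?szh // (nE _ (ltn_ord i)).
    by congr (val (f _)); apply: val_inj.
move=> /andP[/andP[_ it] /eqP E]; rewrite it mul1r.
have fF : f \in family (fun (i : 'I_r) (x : 'I_w) => nth 0 s i <= x < nth 0 s i.+1)%N.
  move/interlacedP: it => [sz H].
  apply/famP => i; rewrite -E ffunE.
  have cX : #|h f| = r by move: sz; rewrite szs size_values => -[].
  by rewrite -nth_values ?cX // H // size_values cX.
by apply: Gext => i ir; rewrite (values_imset (mono _ fF)).
Qed.

(** The hockey-stick identity. *)
Lemma sum_binomial (w a b j : nat) : (a <= b)%N -> (b <= w)%N ->
  \sum_(x < w | (a <= x < b)%N) ('C(x, j))%:R = ('C(b, j.+1))%:R - ('C(a, j.+1))%:R :> rat.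
Proof.
move=> ab bw.
rewrite -(big_mkord (fun x => a <= x < b)%N (fun x => ('C(x, j))%:R : rat)).
rewrite (big_cat_nat (n := b)) //= [X in _ + X]big1_seq ?addr0; last first.
  by move=> i; rewrite mem_index_iota; lia.
rewrite (big_cat_nat (n := a)) //= [X in X + _]big1_seq ?add0r; last first.
  by move=> i; rewrite mem_index_iota; lia.
rewrite -big_nat.
rewrite -(telescope_sumr (fun i => ('C(i, j.+1))%:R)) //.
by apply: eq_bigr => i _; rewrite binS natrD addrAC subrr add0r.
Qed.

(** By induction on the height r.  Summing C(x_i, j) over x_i in the interval from s_i to
s_(i+1) gives C(s_(i+1), j+1) - C(s_i, j+1), and these differences of consecutive
rows are what the determinant of the C(s_i, j) reduces to, its first column being
constant.  When the number of dents differs from r there are too many triangles of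
one orientation. *)
Lemma num_tilings_trapezoid w h c r y0 s : (y0 + r = h)%N -> (h <= c.+1)%N -> (c - y0 < w)%N ->
  sorted ltn s -> all (fun i => i + y0 <= c)%N s -> (r = 0%N -> s = [::]) ->
  (num_tilings w h (trapezoid y0 c s))%:R =
    (size s == r)%:R * \det (\matrix_(i < r, j < r) ('C(nth 0%N s i, j))%:R) :> rat.
Proof.
elim: r y0 s => [|r IH] y0 s yh hc cw ss sc s0.
  rewrite s0 // eqxx det_mx00 mulr1 num_tilings_empty // => x y b _ yh'.
  by rewrite /trapezoid negb_and -ltnNge -yh addn0 in yh' *; rewrite yh'.
have w0 : (0 < w)%N by apply: leq_ltn_trans cw.
rewrite num_tilings_trapezoid_step //; try lia.
set J := [set x : 'I_w | _].
pose G (g : nat -> nat) : rat := \det (\matrix_(i < r, j < r) ('C(g i, j))%:R).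
have -> : (\sum_(X : {set 'I_w} | X \subset J)
   interlaced s (values X) * num_tilings w h (trapezoid y0.+1 c (values X)))%:R =
   (size s == r.+1)%:R * \sum_(X : {set 'I_w} | X \subset J) (interlaced s (values X))%:R * G
     (nth 0%N (values X)) :> rat.
  rewrite natr_sum mulr_sumr; apply: eq_bigr => X /subsetP XJ.
  rewrite natrM IH ?values_sorted //; first 1 last.
  - lia.
  - lia.
  - by rewrite all_values; apply/forall_inP => i /XJ; rewrite inE => /andP[].
  - move=> r0; apply/size0nil; rewrite size_values; apply: eq_card0 => x.
    by apply/negP => /XJ; rewrite inE; lia.
  have [/interlacedP[-> _]|_] := boolP (interlaced _ _); last by rewrite !mul0r mulr0.
  by rewrite eqSS !mul1r.
have [szs|] := eqVneq (size s) r.+1; last by rewrite !mul0r.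
rewrite !mul1r (@sum_interlaced _ w r s J G) //; last first.
- move=> i x xs; rewrite inE; have := ltn_ord i.
  move/allP/(_ (nth 0 s i.+1)%N): sc => /= /(_ (mem_nth _ _)); rewrite szs ltnS => H ir.
  have := H ir; lia.
- by move=> g g' H; congr (\det _); apply/matrixP => i j; rewrite !mxE H.
rewrite (@det_first_col1 _ r (fun i j => ('C(nth 0%N s i, j))%:R)) => [|i]; last by rewrite bin0.
transitivity (\det (\matrix_(i < r, j < r)
    \sum_(x < w | (nth 0 s i <= x < nth 0 s i.+1)%N) ('C(x, j))%:R : 'M[rat]_r)).
  rewrite -(sum_det_rows _ (fun (i j : 'I_r) (x : 'I_w) => ('C(x, j))%:R)).
  apply: eq_bigr => f _; congr (\det _); apply/matrixP => i j; rewrite !mxE.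
  by rewrite (nth_map i) ?size_enum_ord // nth_ord_enum.
congr (\det _); apply/matrixP => i j; rewrite !mxE sum_binomial //.
  apply: ltnW; rewrite (sorted_ltn_nth ltn_trans) // inE szs; have := ltn_ord i; lia.
move/allP/(_ (nth 0 s i.+1)%N): sc => /= /(_ (mem_nth _ _)); rewrite szs ltnS => H.
have := H (ltn_ord i); lia.
Qed.

(** * Sums of squared Vandermonde products *)

(** Expanding the first determinant over permutations s and substituting f o s for f turns
each of the k! terms into the same sum, to which [sum_det_rows] applies. *)
Lemma andreief (R : comRingType) (X : finType) (k : nat)
    (om : X -> R) (p q : 'I_k -> X -> R) :
  \sum_(f : {ffun 'I_k -> X}) (\prod_i om (f i)) *
     \det (\matrix_(i, j) p j (f i)) * \det (\matrix_(i, j) q j (f i)) =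
  (k`!)%:R * \det (\matrix_(i, j) \sum_x om x * p i x * q j x).
Proof.
pose T := \det (\matrix_(i, j) \sum_x om x * p i x * q j x).
transitivity (\sum_(s : 'S_k) T); last by rewrite sumr_const card_Sn mulr_natl.
rewrite (eq_bigr (fun f : {ffun 'I_k -> X} => \sum_(s : 'S_k) (\prod_i om (f i)) *
   ((-1) ^+ s * \prod_i (\matrix_(i, j) p j (f i)) i (s i)) *
   \det (\matrix_(i, j) q j (f i)))); last first.
  by move=> f _; rewrite -mulr_suml -mulr_sumr.
rewrite exchange_big /=; apply: eq_bigr => s _.
rewrite (reindex_inj (h := fun g : {ffun 'I_k -> X} => [ffun i => g (s i)])) /=; last first.
  move=> f g /ffunP E; apply/ffunP => i; have := E (s^-1 i)%g.
  by rewrite !ffunE permKV.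
rewrite /T -(sum_det_rows (fun=> xpredT) (fun i j x => om x * p i x * q j x)).
apply: eq_big => [g|g _]; first by apply/esym/familyP.
have -> : \prod_i om ([ffun i => g (s i)] i) = \prod_i om (g i).
  under eq_bigr => i _ do rewrite ffunE.
  by rewrite [RHS](reindex_inj (@perm_inj _ s)).
have -> : \prod_i (\matrix_(i, j) p j ([ffun i => g (s i)] i)) i (s i) = \prod_i p i (g i).
  under eq_bigr => i _ do rewrite mxE ffunE.
  by rewrite [RHS](reindex_inj (@perm_inj _ s)).
have -> : \det (\matrix_(i, j) q j ([ffun i => g (s i)] i)) =
    (-1) ^+ s * \det (\matrix_(i, j) q j (g i)).
  rewrite -det_perm -det_mulmx -row_permE; congr (\det _).
  by apply/matrixP => i j; rewrite !mxE ffunE.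
have -> : \det (\matrix_(i, j) (om (g i) * p i (g i) * q j (g i))) =
   (\prod_i (om (g i) * p i (g i))) * \det (\matrix_(i, j) q j (g i)).
  have -> : \prod_i (om (g i) * p i (g i)) =
     \det (diag_mx (\row_i (om (g i) * p i (g i)))).
    by rewrite det_diag; apply: eq_bigr => i _; rewrite mxE.
  rewrite -det_mulmx; congr (\det _); apply/matrixP => i j.
  by rewrite mul_diag_mx !mxE.
rewrite big_split /=; set a := \prod_i om _; set b := \prod_i p _ _; set d := \det _.
have regroup (t x y z : R) : x * (t * y) * (t * z) = (t * t) * (x * y * z) by ring.
rewrite regroup -expr2 sqrr_sign mul1r //.
Qed.

(** The factor of a and b in a Vandermonde product over a set, equal to 1 unless a < b;
this removes the condition a < b from products over pairs. *)
Definition gap (a b : nat) : rat := if (a < b)%N then b%:R - a%:R else 1.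

Definition set_vandermonde w (X : {set 'I_w}) : rat := \prod_(a in X) \prod_(b in X) gap a b.

Lemma prod_values w (X : {set 'I_w}) r (F : nat -> rat) : #|X| = r ->
  \prod_(a in X) F a = \prod_(i < r) F (nth 0%N (values X) i).
Proof.
move=> <-; rewrite -big_enum /= -(big_map val xpredT F) (big_nth 0%N).
by rewrite size_map -cardE big_mkord.
Qed.

Lemma prod_values_vandermonde w (X : {set 'I_w}) r : #|X| = r ->
  \prod_(i < r) \prod_(j < r | (i < j)%N)
     ((nth 0%N (values X) j)%:R - (nth 0%N (values X) i)%:R) = set_vandermonde X.
Proof.
move=> Xr; rewrite /set_vandermonde (prod_values (fun a => \prod_(b in X) gap a b) Xr).
apply: eq_bigr => i _; rewrite (prod_values (gap _) Xr).
rewrite [LHS]big_mkcond; apply: eq_bigr => j _; rewrite /gap.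
have := sorted_ltn_nth ltn_trans 0%N (values_sorted X).
have inX (l : 'I_r) : (l : nat) \in [pred i : nat | (i < size (values X))%N].
  by rewrite inE size_values Xr.
move=> mono; have [ij|ji|->] := ltngtP i j; last by rewrite ltnn.
  by rewrite (mono i j (inX i) (inX j) ij).
by rewrite ltnNge (ltnW (mono j i (inX j) (inX i) ji)).
Qed.

Lemma det_binomial_values w (X : {set 'I_w}) r : #|X| = r ->
  \det (\matrix_(i < r, j < r) ('C(nth 0%N (values X) i, j))%:R) * \prod_(j < r) (j`!)%:R =
    set_vandermonde X.
Proof.
by move=> Xr; rewrite (det_binomial (fun i => nth 0%N (values X) i)) prod_values_vandermonde.
Qed.

Lemma set_vandermonde_rev w (X : {set 'I_w}) : set_vandermonde (@rev_ord w @^-1: X) =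
  set_vandermonde X.
Proof.
rewrite /set_vandermonde [RHS]exchange_big /= (reindex_inj rev_ord_inj) /=.
apply: eq_big => [a|a _]; first by rewrite inE rev_ordK.
rewrite (reindex_inj rev_ord_inj) /=.
apply: eq_big => [b|b _]; first by rewrite inE rev_ordK.
rewrite /gap /=; have := ltn_ord a; have := ltn_ord b => bw aw.
rewrite ltn_sub2lE // ltnS; case: ifP => // ba.
by rewrite !natrB //; ring.
Qed.

Lemma set_vandermonde_setU1 w (X : {set 'I_w}) n : n \notin X ->
  set_vandermonde (n |: X) = set_vandermonde X * \prod_(x in X) `|x%:R - n%:R|.
Proof.
move=> nX; rewrite /set_vandermonde big_setU1 //= [X in X * _]big_setU1 //=.
rewrite [X in _ * X](eq_bigr (fun a : 'I_w => gap a n * \prod_(b in X) gap a b)); last first.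
  by move=> a _; rewrite big_setU1.
rewrite {1}/gap ltnn mul1r big_split /= mulrA -big_split /= mulrC; congr (_ * _).
apply: eq_bigr => x xX; rewrite /gap.
have [lt|lt|E] := ltngtP n x.
- by rewrite mulr1 ger0_norm // subr_ge0 ler_nat ltnW.
- by rewrite mul1r ler0_norm ?opprB // subr_le0 ler_nat ltnW.
- by move: nX; rewrite (val_inj E) xX.
Qed.

Definition point_dist (a b : nat) : rat := if a == b then 1 else `|a%:R - b%:R|.

(** The square is symmetric in its factors, so it can be reindexed by any enumeration of X
without keeping track of the order. *)
Lemma set_vandermonde_sqr w (X : {set 'I_w}) :
  set_vandermonde X ^+ 2 = \prod_(a in X) \prod_(b in X) point_dist a b.
Proof.
rewrite expr2 {2}/set_vandermonde exchange_big /= -big_split /=; apply: eq_bigr => a _.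
rewrite -big_split /=; apply: eq_bigr => b _; rewrite /gap /point_dist.
have [lt|lt|E] := ltngtP a b.
- by rewrite mulr1 ler0_norm ?opprB // subr_le0 ler_nat ltnW.
- by rewrite mul1r ger0_norm // subr_ge0 ler_nat ltnW.
- by rewrite mulr1.
Qed.

Lemma vandermonde_sqr w k n (f : {ffun 'I_k -> 'I_w}) :
  (\prod_(i < k) \prod_(j < k | (i < j)%N) (((f j)%:R - n) - ((f i)%:R - n))) ^+ 2 =
  if injectiveb f then set_vandermonde [set f i | i in 'I_k] ^+ 2 else 0 :> rat.
Proof.
have E i j : (f j)%:R - n - ((f i)%:R - n) = (f j)%:R - (f i)%:R :> rat by ring.
under eq_bigr => i _ do under eq_bigr => j _ do rewrite E.
case: injectiveP => [inj|ninj]; last first.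
  have : ~~ injectiveb f by apply/injectiveP.
  case/injectivePn => i [j ij fij].
  wlog lt : i j ij fij / (i < j)%N.
    move=> H; have := ij; rewrite neq_ltn => /orP[lt|lt]; first exact: (H i j).
    by apply: (H j i) => //; rewrite eq_sym.
  by rewrite (bigD1 i) //= (bigD1 j) //= fij subrr !mul0r expr0n.
rewrite set_vandermonde_sqr big_imset /=; last by move=> ? ? _ _; apply: inj.
rewrite [RHS](eq_bigr (fun i => \prod_j point_dist (f i) (f j))); last first.
  by move=> i _; rewrite big_imset //=; move=> ? ? _ _; apply: inj.
have sqr (z : rat) : z ^+ 2 = `|z| ^+ 2 by rewrite real_normK ?num_real.
rewrite sqr normr_prod.
under eq_bigr => i _ do rewrite normr_prod big_mkcond.
rewrite expr2 {2}exchange_big /= -big_split /=; apply: eq_bigr => i _.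
rewrite -big_split /=; apply: eq_bigr => j _; rewrite /point_dist.
rewrite (inj_eq val_inj) (inj_eq inj) -val_eqE /=.
by have [lt|lt|E'] := ltngtP i j; rewrite ?mulr1 ?mul1r // distrC.
Qed.

(** Injections of k points into a set of k points are onto. *)
Lemma card_injections_onto w k (X : {set 'I_w}) : #|X| = k ->
  #|[set f : {ffun 'I_k -> 'I_w} | injectiveb f && ([set f i | i in 'I_k] == X)]| = k`!.
Proof.
move=> Xk; have := card_inj_ffuns_on 'I_k (mem X); rewrite card_ord Xk ffactnn => <-.
apply: eq_card => f; rewrite !inE andbC; apply: andb_id2r => /injectiveP inj.
apply/eqP/ffun_onP => [<- i|fX]; first exact: imset_f.
apply/eqP; rewrite eqEcard Xk card_imset // card_ord leqnn andbT.
by apply/subsetP => _ /imsetP[i _ ->].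
Qed.

(** Andreief's identity on the functions f from k points: a determinant vanishes when f is not
injective, and each set X is the image of k! injective functions. *)
Lemma sum_set_vandermonde_sqr w k (n : rat) (om : 'I_w -> rat) (P Q : nat -> {poly rat}) :
  (forall j, P j \is monic) -> (forall j, size (P j) = j.+1) ->
  (forall j, Q j \is monic) -> (forall j, size (Q j) = j.+1) ->
  \sum_(X : {set 'I_w} | #|X| == k) set_vandermonde X ^+ 2 * \prod_(x in X) om x =
  \det (\matrix_(i < k, j < k) \sum_x om x * (P i).[x%:R - n] * (Q j).[x%:R - n]).
Proof.
move=> Pm Ps Qm Qs.
have k0 : (k`!)%:R != 0 :> rat by rewrite pnatr_eq0 -lt0n fact_gt0.
apply: (mulfI k0).
rewrite -(andreief om (fun i x => (P i).[x%:R - n]) (fun i x => (Q i).[x%:R - n])).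
under [RHS]eq_bigr => f _ do rewrite (det_monic_basis (fun i => (f i)%:R - n) Pm Ps)
    (det_monic_basis (fun i => (f i)%:R - n) Qm Qs) -mulrA -expr2 vandermonde_sqr.
rewrite (bigID (fun f : {ffun 'I_k -> 'I_w} => injectiveb f)) /= [X in _ = _ + X]big1 ?addr0;
  last first.
  by move=> f /negPf ->; rewrite mulr0.
rewrite (partition_big (fun f : {ffun 'I_k -> 'I_w} => [set f i | i in 'I_k])
     (fun X : {set 'I_w} => #|X| == k)) /=; last first.
  by move=> f /injectiveP inj; rewrite card_imset // card_ord.
rewrite mulr_sumr; apply: eq_bigr => X /eqP Xk.
rewrite mulr_natl -(card_injections_onto Xk) -sumr_const.
apply: eq_big => [f|f]; rewrite !inE // => /andP[/injectiveP inj /eqP <-].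
rewrite mulrC; move/injectiveP: (inj) => ->; congr (_ * _).
by rewrite big_imset //=; move=> ? ? _ _; apply: inj.
Qed.

(** Both trapezoids contribute Vandermonde products; that of X with n added is that of X times
prod |x - n|.  Sets that contain n may be added as this factor vanishes for them. *)
Lemma card_tilings_det n k (P Q : nat -> {poly rat}) : (0 < k)%N -> (k <= 2 * n)%N ->
  (forall j, P j \is monic) -> (forall j, size (P j) = j.+1) ->
  (forall j, Q j \is monic) -> (forall j, size (Q j) = j.+1) ->
  #|tilings (holed_hexagon n k)|%:R * ((\prod_(j < k) (j`!)%:R) * \prod_(j < k.+1) (j`!)%:R) =
  \det (\matrix_(i < k, j < k) \sum_(x < (2 * n).+1)
     `|x%:R - n%:R| * (P i).[x%:R - n%:R] * (Q j).[x%:R - n%:R]).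
Proof.
move=> k0 kn Pm Ps Qm Qs.
have wE : (2 * n + 1 - k + k = (2 * n).+1)%N by lia.
have nw : (n < 2 * n + 1 - k + k)%N by lia.
pose n0 := Ordinal nw.
rewrite (card_tilings_cut k0 kn (n0 := n0)) // natr_sum mulr_suml.
transitivity (\sum_(X : {set 'I_(2 * n + 1 - k + k)} | #|X| == k)
   set_vandermonde X ^+ 2 * \prod_(x in X) `|x%:R - n%:R|); last first.
  rewrite (sum_set_vandermonde_sqr k n%:R (fun x => `|x%:R - n%:R|) Pm Ps Qm Qs).
  by move: (2 * n + 1 - k + k)%N wE => w ->.
rewrite [RHS](bigID (fun X : {set 'I_(2 * n + 1 - k + k)} => n0 \in X)) /=.
rewrite [X in _ = X + _]big1 ?add0r => [|X /andP[_ nX]]; last first.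
  by rewrite (bigD1 n0) //= subrr normr0 mul0r mulr0.
rewrite [RHS](eq_bigl (fun X : {set 'I_(2 * n + 1 - k + k)} => (X \subset ~: [set n0]) && (#|X|
  == k))); last first.
  by move=> X; rewrite andbC subsetC sub1set inE.
rewrite big_mkcondr; apply: eq_bigr => X XJ.
have nX : n0 \notin X by move: XJ; rewrite subsetC sub1set inE.
have szr : size (values (@rev_ord _ @^-1: (n0 |: X))) = #|X|.+1.
  rewrite size_values on_card_preimset ?cardsU1 ?nX //.
  by exists (@rev_ord (2 * n + 1 - k + k)) => i _; rewrite rev_ordK.
rewrite natrM (@num_tilings_trapezoid _ _ _ k k.+1) ?(@num_tilings_trapezoid _ _ _ k.+1 k)
  ?values_sorted //; try lia;
  try (rewrite all_values; apply/forall_inP => i _; have /= := ltn_ord i; lia).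
rewrite szr size_values eqSS; case: eqP => [Xk|_]; last by rewrite !mul0r.
have Yk : #|@rev_ord _ @^-1: (n0 |: X)| = k.+1 by rewrite -size_values szr Xk.
rewrite !mul1r mulrACA (det_binomial_values Xk) (det_binomial_values Yk).
by rewrite set_vandermonde_rev set_vandermonde_setU1 // mulrA.
Qed.

(** * A Hankel-type determinant of Pochhammer ratios *)

(** The rising factorial of x. *)
Definition poch (x : rat) (t : nat) : rat := \prod_(l < t) (x + l%:R).

Lemma poch0 x : poch x 0 = 1. Proof. by rewrite /poch big_ord0. Qed.

Lemma pochSr x t : poch x t.+1 = poch x t * (x + t%:R).
Proof. by rewrite /poch big_ord_recr. Qed.

Lemma pochSl x t : poch x t.+1 = x * poch (x + 1) t.
Proof.
rewrite /poch big_ord_recl addr0; congr (_ * _); apply: eq_bigr => l _.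
by rewrite /= -addrA -[l.+1%:R]natr1 [1 + _]addrC.
Qed.

Lemma poch_gt0 x t : 0 < x -> 0 < poch x t.
Proof. by move=> x0; apply: prodr_gt0 => l _; rewrite ltr_wpDr. Qed.

Lemma poch_fact a t : poch a.+1%:R t * (a`!)%:R = ((a + t)`!)%:R.
Proof.
elim: t => [|t IH]; first by rewrite poch0 mul1r addn0.
by rewrite pochSr mulrAC IH addnS factS -natrD addSn natrM mulrC.
Qed.

Definition poch_ratio (A B : rat) (j : nat) : rat := poch A j / poch B j.

(** The quotient of the determinants of [det_ratio] of sizes t + 1 and t. *)
Definition rho (t : nat) (A B : rat) : rat :=
  (t`!)%:R * poch (B - A) t / (poch (B + t%:R - 1) t * poch (B + t%:R) t).

Lemma ratio_diff A B j : 0 < B ->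
  poch_ratio (A + 1) (B + 1) j.+1 - poch_ratio A B j.+1 =
  j.+1%:R * ((B - A) / (B * (B + 1))) * poch_ratio (A + 1) (B + 2) j.
Proof.
move=> B0; rewrite /poch_ratio [poch A _]pochSl [poch B _]pochSl.
rewrite [poch (A + 1) j.+1]pochSr.
have B1 : poch (B + 1) j.+1 != 0 by rewrite gt_eqF // poch_gt0 // addr_gt0.
have B2 : poch (B + 1) j != 0 by rewrite gt_eqF // poch_gt0 // addr_gt0.
have B3 : poch (B + 2) j != 0 by rewrite gt_eqF // poch_gt0 // addr_gt0.
have Bj : 0 < B + 1 + j%:R by rewrite ltr_wpDr // addr_gt0.
have E1 : poch (B + 1) j.+1 = (B + 1) * poch (B + 2) j.
  by rewrite pochSl; congr (_ * poch _ _); ring.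
have E2 : poch (B + 1) j * (B + 1 + j%:R) = (B + 1) * poch (B + 2) j by rewrite -E1 pochSr.
have E3 : poch (B + 1) j = (B + 1) * poch (B + 2) j / (B + 1 + j%:R).
  by rewrite -E2 mulfK // gt_eqF.
rewrite E1 E3 -[j.+1%:R]natr1.
field.
by rewrite B3 !gt_eqF // addr_gt0.
Qed.

Lemma rhoS t A B : 0 < B ->
  rho t.+1 A B = t.+1%:R * ((B - A) / ((B + t%:R) * (B + t.+1%:R))) * rho t (A + 1) (B + 2).
Proof.
move=> B0; rewrite /rho [poch (B - A) _]pochSl [poch (_ - 1) _]pochSl.
rewrite [poch (B + t.+1%:R) t.+1]pochSl factS natrM.
have -> : B + 2 - (A + 1) = B - A + 1 by ring.
have -> : B + t.+1%:R - 1 = B + t%:R by rewrite -natr1; ring.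
have -> : B + t%:R + 1 = B + t.+1%:R by rewrite -natr1; ring.
have -> : B + 2 + t%:R - 1 = B + t.+1%:R by rewrite -natr1; ring.
have -> : B + t.+1%:R + 1 = B + 2 + t%:R by rewrite -natr1; ring.
have Bt : 0 < B + t%:R by rewrite ltr_wpDr.
have Bt1 : 0 < B + t.+1%:R by rewrite ltr_wpDr.
have Bt2 : 0 < B + 2 + t%:R by rewrite ltr_wpDr // addr_gt0.
have p1 : poch (B + t.+1%:R) t != 0 by rewrite gt_eqF // poch_gt0.
have p2 : poch (B + 2 + t%:R) t != 0 by rewrite gt_eqF // poch_gt0.
move: (t.+1%:R) p1 Bt1 => t1 p1 Bt1.
field.
by rewrite p1 p2 !gt_eqF.
Qed.

(** The first column is 1, so [det_first_col1] applies; by [ratio_diff] the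
differences are entries of the same kind at A + 1 and B + 2, up to row and column factors. *)
Lemma det_ratio m A B : 0 < B ->
  \det (\matrix_(i < m, j < m) poch_ratio (A + i%:R) (B + i%:R) j) = \prod_(t < m) rho t A B.
Proof.
elim: m A B => [|m IH] A B B0; first by rewrite det_mx00 big_ord0.
rewrite (@det_first_col1 _ m (fun i j => poch_ratio (A + i%:R) (B + i%:R) j)); last first.
  by move=> i; rewrite /poch_ratio !poch0 divr1.
pose c (i : nat) := (B - A) / ((B + i%:R) * (B + i.+1%:R)).
have -> : \matrix_(i < m, j < m) (poch_ratio (A + i.+1%:R) (B + i.+1%:R) j.+1 - poch_ratio (A +
  i%:R) (B + i%:R) j.+1) =
   diag_mx (\row_(i < m) c i) *m (\matrix_(i < m, j < m) poch_ratio (A + 1 + i%:R) (B + 2 + i%:R) j)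
     *m diag_mx (\row_(j < m) j.+1%:R).
  apply/matrixP => i j; rewrite mul_mx_diag mul_diag_mx !mxE /c.
  have Bi : 0 < B + i%:R by rewrite ltr_wpDr.
  have := ratio_diff (A + i%:R) j Bi.
  have -> : A + i%:R + 1 = A + i.+1%:R by rewrite -natr1 addrA.
  have -> : B + i%:R + 1 = B + i.+1%:R by rewrite -natr1 addrA.
  move=> ->; have -> : B + i%:R - (A + i%:R) = B - A by ring.
  have -> : A + 1 + i%:R = A + i.+1%:R by rewrite -natr1; ring.
  have -> : B + 2 + i%:R = B + i%:R + 2 by ring.
  by rewrite -mulrA mulrC.
rewrite !det_mulmx !det_diag IH ?addr_gt0 // big_ord_recl /=.
have -> : rho 0 A B = 1 by rewrite /rho !poch0.
rewrite mul1r -!big_split /=; apply: eq_bigr => t _; rewrite !mxE.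
by rewrite [RHS]rhoS // /c; ring.
Qed.

(** * Moments of |y| on the integers from -n to n *)

(** Positions x = 0, ..., 2n are centred at n, then folded around 0. *)
Lemma sum_centered (n : nat) (F : rat -> rat) : F 0 = 0 ->
  \sum_(x < (2 * n).+1) F (x%:R - n%:R) = \sum_(1 <= m < n.+1) (F m%:R + F (- m%:R)).
Proof.
move=> F0; rewrite -(big_mkord xpredT (fun x => F (x%:R - n%:R))).
rewrite (big_cat_nat (n := n)) //=; last by lia.
rewrite addrC big_ltn; last by lia.
rewrite subrr F0 add0r big_split /=; congr (_ + _).
  rewrite [LHS]big_add1 [RHS]big_add1 /= -{1}[n]add0n big_addn (_ : 2 * n - n = n)%N; last by lia.
  by apply: eq_bigr => i _; rewrite -addSn natrD addrK.
rewrite [RHS]big_add1 /= big_nat_rev /= add0n; apply: eq_big_nat => i /andP[_ iN].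
by congr (F _); rewrite natrB // addrC addrA addNr add0r.
Qed.

(** Monic polynomials of degree j with the parity of j, so that the products of two of them
with degrees of different parities are odd functions. *)
Definition parity_basis (c : nat -> rat) (j : nat) : {poly rat} :=
  (if odd j then 'X else 1) * \prod_(l < j./2) ('X^2 - (c l)%:P).

Lemma monic_parity_factor (b : bool) : (if b then 'X else 1 : {poly rat}) \is monic.
Proof. by case: b; rewrite ?monicX ?monic1. Qed.

Lemma monic_parity_prod (c : nat -> rat) m : \prod_(l < m) ('X^2 - (c l)%:P) \is monic.
Proof. by apply: monic_prod => l _; rewrite monicXnsubC. Qed.

Lemma parity_basis_monic c j : parity_basis c j \is monic.
Proof. by rewrite /parity_basis monicMl ?monic_parity_prod ?monic_parity_factor. Qed.

Lemma size_parity_basis c j : size (parity_basis c j) = j.+1.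
Proof.
rewrite size_monicM ?monic_parity_factor ?monic_neq0 ?monic_parity_prod //.
rewrite size_prod => [|l _]; last by rewrite monic_neq0 ?monicXnsubC.
under eq_bigr => l _ do rewrite size_XnsubC //.
rewrite sum_nat_const card_ord.
have := odd_double_half j; case: (odd j); rewrite ?size_polyX ?size_poly1; lia.
Qed.

Lemma horner_parity_basis c j y :
  (parity_basis c j).[y] = y ^+ odd j * \prod_(l < j./2) (y ^+ 2 - c l).
Proof.
rewrite /parity_basis hornerM horner_prod; congr (_ * _).
  by case: odd; rewrite ?hornerX ?hornerC ?expr1 ?expr0.
by apply: eq_bigr => l _; rewrite !hornerE.
Qed.

Definition factor (n j : nat) : rat := (n%:R - j%:R) * (n%:R + 1 + j%:R).

(** The falling factorial (n + t)(n + t - 1) ... (n - t + 1), with its factors grouped in pairs. *)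
Definition factor_prod (n t : nat) : rat := \prod_(l < t) factor n l.

(** Twice the half range sum of y^(1 + 2b) P(y) Q(y), where P and Q are the even polynomials
whose positive roots are 1, ..., i and n + 1, ..., n + j.
  The flag b stands for odd degrees, where the
two factors y add y^2 to the weight. *)
Definition moment (b : bool) (n i j : nat) : rat :=
  \sum_(1 <= m < n.+1) m%:R ^+ (1 + 2 * b) *+ 2 *
     \prod_(l < i) (m%:R ^+ 2 - l.+1%:R ^+ 2) * \prod_(l < j) (m%:R ^+ 2 - (n + l.+1)%:R ^+ 2).

(** The new factors y^2 - (i+1)^2 and y^2 - (n+j+1)^2 of P and Q differ by a constant. *)
Lemma moment_recr b n i j : moment b n i j.+1 =
  moment b n i.+1 j - (n%:R + j%:R - i%:R) * (n%:R + i%:R + j%:R + 2) * moment b n i j.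
Proof.
rewrite /moment mulr_sumr -sumrB; apply: eq_bigr => m _.
rewrite !big_ord_recr /= addnS -!natr1 !natrD; ring.
Qed.

(** The summand m prod (m^2 - l^2) is a falling factorial with an odd number of factors,
which telescopes: it is a difference of two values of [factor_prod]. *)
Lemma moment0_even n i : moment false n i 0 = factor_prod n i.+1 / i.+1%:R.
Proof.
have i0 : i.+1%:R != 0 :> rat by rewrite pnatr_eq0.
(* Y m i = (m - i) ... (m + i) is the common part of [factor_prod] at m - 1 and at m. *)
pose Y (m i : nat) : rat := m%:R * \prod_(l < i) (m%:R ^+ 2 - l.+1%:R ^+ 2).
have U1 m : factor_prod m i.+1 = Y m.+1 i * (m%:R - i%:R).
  rewrite /factor_prod /Y /factor; elim: (i) => [|k IH];
    first by rewrite big_ord1 big_ord0 /= -[m.+1%:R]natr1; ring.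
  by rewrite big_ord_recr IH /= [in RHS]big_ord_recr /= -!natr1; ring.
have U2 m : factor_prod m.+1 i.+1 = Y m.+1 i * (m%:R + i%:R + 2).
  rewrite /factor_prod /Y /factor; elim: (i) => [|k IH];
    first by rewrite big_ord1 big_ord0 /= -[m.+1%:R]natr1; ring.
  by rewrite big_ord_recr IH /= [in RHS]big_ord_recr /= -!natr1; ring.
rewrite /moment; under eq_bigr => m _ do rewrite big_ord0 mulr1.
elim: n => [|n IH].
  by rewrite big_geq // /factor_prod big_ord_recl /factor subrr !mul0r.
rewrite big_nat_recr //= IH U1 U2 /Y expr1.
apply: (mulIf i0); rewrite mulrDl !divfK // -mulr_natl -[i.+1%:R]natr1; ring.
Qed.

(** The extra m^2 of the odd case is (m^2 - (i+1)^2) + (i+1)^2. *)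
Lemma moment0 b n i : moment b n i 0 = (n%:R * (n%:R + 1)) ^+ b * factor_prod n i.+1 / (i.+1 +
  b)%:R.
Proof.
case: b; last by rewrite moment0_even addn0 expr0 mul1r.
have -> : moment true n i 0 = moment false n i.+1 0 + i.+1%:R ^+ 2 * moment false n i 0.
  rewrite /moment mulr_sumr -big_split; apply: eq_bigr => m _ /=.
  by rewrite !big_ord_recr !big_ord0 /=; ring.
rewrite !moment0_even {1}/factor_prod big_ord_recr /= -/(factor_prod n i.+1) {1}/factor addn1 expr1.
have i0 : i.+1%:R != 0 :> rat by rewrite pnatr_eq0.
have i1 : i.+2%:R != 0 :> rat by rewrite pnatr_eq0.
move: i1; rewrite -[i.+2%:R]natr1; move: (i.+1%:R) i0 => I i0 i1; field.
by rewrite i0 i1.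
Qed.

Lemma moment0S b n i : moment b n i.+1 0 =
  moment b n i 0 * ((n%:R - i.+1%:R) * (n%:R + i%:R + 2) * (i.+1 + b)%:R / (i.+2 + b)%:R).
Proof.
rewrite !moment0 [factor_prod n i.+2]/factor_prod big_ord_recr /= -/(factor_prod n i.+1) /factor.
have i0 : (i.+1 + b)%:R != 0 :> rat by rewrite addSn pnatr_eq0.
have i1 : (i.+2 + b)%:R != 0 :> rat by rewrite addSn pnatr_eq0.
have -> : n%:R + 1 + i.+1%:R = n%:R + i%:R + 2 :> rat by rewrite -natr1; ring.
move: (i.+1 + b)%:R i0 (i.+2 + b)%:R i1 (i.+1%:R) => I i0 J i1 K; field.
by rewrite i0 i1.
Qed.

(** The recurrence [moment_recr] determines all moments from those with j = 0. *)
Lemma momentE b n i j : moment b n i j = moment b n i 0 *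
  ((-1) ^+ j * (j`!)%:R * poch (n + b).+1%:R j) * poch_ratio (n.+2%:R + i%:R) ((2 + b)%:R + i%:R) j.
Proof.
elim: j i => [|j IH] i; first by rewrite /poch_ratio !poch0 !mulr1.
(* In terms of A, B, i and j what remains is an identity between rational functions. *)
pose A : rat := n.+2%:R + i%:R; pose B : rat := (2 + b)%:R + i%:R.
have A0 : 0 < A by rewrite ltr_wpDr.
have B0 : 0 < B by rewrite ltr_wpDr // ltr0n.
have Aj : 0 < A + j%:R by rewrite ltr_wpDr.
have Bj : 0 < B + j%:R by rewrite ltr_wpDr.
have pB : 0 < poch B j by rewrite poch_gt0.
have shift x : 0 < x -> poch (x + 1) j = poch x j * (x + j%:R) / x.
  by move=> x0; rewrite -pochSr pochSl mulrC mulKf // gt_eqF.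
rewrite moment_recr !IH moment0S exprS factS natrM pochSr /poch_ratio -/A -/B.
have -> : n.+2%:R + i.+1%:R = A + 1 by rewrite /A -[i.+1%:R]natr1 addrA.
have -> : (2 + b)%:R + i.+1%:R = B + 1 by rewrite /B -[i.+1%:R]natr1 addrA.
rewrite !shift // !pochSr.
have -> : (i.+1 + b)%:R = B - 1 by rewrite /B !natrD -[i.+1%:R]natr1; ring.
have -> : (i.+2 + b)%:R = B by rewrite /B !natrD -[i.+2%:R]natr1 -[i.+1%:R]natr1; ring.
have -> : (n + b).+1%:R = A + B - 2 * i%:R - 3 :> rat.
  by rewrite /A /B -!natr1 !natrD; ring.
have -> : n%:R = A - i%:R - 2 by rewrite /A -!natr1; ring.
rewrite -[j.+1%:R]natr1 -[i.+1%:R]natr1.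
field.
by rewrite !gt_eqF.
Qed.

(** The squared norm of the monic polynomial of degree 2t + b that is orthogonal to lower
degrees for the weight |y| on the integers from -n to n, as long as 2t + b <= 2n. *)
Definition moment_norm (b : bool) (n t : nat) : rat :=
  factor_prod n t.+1 * factor_prod n (t + b) * ((t`!)%:R * ((t + b)`!)%:R) ^+ 2
    / (((2 * t + b)`!)%:R * ((2 * t + b).+1`!)%:R).

Lemma fact_neq0 t : (t`!)%:R != 0 :> rat.
Proof. by rewrite pnatr_eq0 -lt0n fact_gt0. Qed.

Lemma poch_factor_prod (b : bool) n t :
  (n%:R * (n%:R + 1)) ^+ b * ((-1) ^+ t * poch (n + b).+1%:R t * poch (b%:R - n%:R) t) =
  factor_prod n (t + b).
Proof.
elim: t => [|t IH].
  rewrite !poch0 expr0 !mulr1 add0n /factor_prod; case: b; last by rewrite big_ord0.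
  by rewrite big_ord1 /factor subr0 addr0.
rewrite [LHS](_ : _ = factor_prod n (t + b) * ((n%:R - (t + b)%:R) * (n%:R + 1 + (t + b)%:R))).
  by rewrite /factor_prod addSn big_ord_recr.
rewrite -IH !pochSr exprS -natr1 !natrD; ring.
Qed.

Lemma det_moment b n m :
  \det (\matrix_(i < m, j < m) moment b n i j) = \prod_(t < m) moment_norm b n t.
Proof.
(* By [momentE] the moments are a matrix of [det_ratio] with rescaled rows and columns. *)
have -> : \matrix_(i < m, j < m) moment b n i j =
  diag_mx (\row_(i < m) moment b n i 0) *m
  (\matrix_(i < m, j < m) poch_ratio (n.+2%:R + i%:R) ((2 + b)%:R + i%:R) j) *m
  diag_mx (\row_(j < m) ((-1) ^+ j * (j`!)%:R * poch (n + b).+1%:R j)).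
  apply/matrixP => i j; rewrite mul_mx_diag mul_diag_mx !mxE.
  by rewrite momentE mulrAC.
rewrite !det_mulmx !det_diag det_ratio ?ltr0n // -!big_split /=.
apply: eq_bigr => t _; rewrite !mxE moment0 /moment_norm -poch_factor_prod /rho.
have -> : (2 + b)%:R - n.+2%:R = b%:R - n%:R :> rat by rewrite natrD -!natr1; ring.
have -> : (2 + b)%:R + t%:R - 1 = (t + b).+1%:R :> rat by rewrite -natr1 !natrD; ring.
have -> : (2 + b)%:R + t%:R = (t + b).+2%:R :> rat by rewrite -!natr1 !natrD; ring.
have f1 : poch (t + b).+1%:R t = ((2 * t + b)`!)%:R / ((t + b)`!)%:R.
  rewrite -(_ : t + b + t = 2 * t + b)%N; last by lia.
  by rewrite -poch_fact mulfK ?fact_neq0.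
have f2 : poch (t + b).+2%:R t = ((2 * t + b).+1`!)%:R / ((t + b).+1`!)%:R.
  rewrite -(_ : (t + b).+1 + t = (2 * t + b).+1)%N; last by lia.
  by rewrite -poch_fact mulfK ?fact_neq0.
rewrite f1 f2 addSn [in (t + b).+1`!]factS natrM.
have z1 := fact_neq0 (2 * t + b); have z2 := fact_neq0 (2 * t + b).+1.
have z3 := fact_neq0 (t + b); have z4 : (t + b).+1%:R != 0 :> rat by rewrite pnatr_eq0.
move: (((2 * t + b)`!)%:R) ((2 * t + b).+1`!%:R) ((t + b)`!%:R) ((t + b).+1%:R) z1 z2 z3 z4.
move=> f3 f4 f5 f6 z1 z2 z3 z4; field.
by rewrite z1 z2 z3 z4.
Qed.

(** With these two bases the matrix of [card_tilings_det] has entries 0 when the parities of i and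
j differ, and moments otherwise. *)
Lemma tilings_moments n m1 m2 : (m2 <= m1 <= m2.+1)%N -> (0 < m1 + m2)%N -> (m1 + m2 <= 2 * n)%N ->
  #|tilings (holed_hexagon n (m1 + m2))|%:R *
    ((\prod_(j < m1 + m2) (j`!)%:R) * \prod_(j < (m1 + m2).+1) (j`!)%:R) =
  (\prod_(t < m1) moment_norm false n t) * (\prod_(t < m2) moment_norm true n t).
Proof.
move=> m12 k0 kn.
pose cP (l : nat) : rat := l.+1%:R ^+ 2; pose cQ (l : nat) : rat := (n + l.+1)%:R ^+ 2.
rewrite (card_tilings_det k0 kn (P := parity_basis cP) (Q := parity_basis cQ));
  do ?[exact: parity_basis_monic | exact: size_parity_basis].
rewrite -!det_moment -(@det_checkerboard _ m1 m2 (fun b i j => moment b n i j)) //;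
  congr (\det _); apply/matrixP => i j; rewrite !mxE.
rewrite (sum_centered n (F := fun y => `|y| * (parity_basis cP i).[y] * (parity_basis cQ j).[y])).
  case: ifPn => [/eqP E|ne]; last first.
    rewrite big1 // => m _; rewrite !horner_parity_basis normrN sqrrN.
    by case: (odd i) (odd j) ne => [] [] // _; rewrite ?expr0 ?expr1; ring.
  rewrite /moment; apply: eq_bigr => m _; rewrite !horner_parity_basis normrN sqrrN -E.
  rewrite ger0_norm ?ler0n //; case: (odd i); rewrite ?expr0 ?expr1; ring.
by rewrite normr0 !mul0r.
Qed.

(** * The product formulas *)

Definition oddprod (q : nat) : rat := \prod_(1 <= j < q) (2 * j%:R + 1).

Lemma oddprodS q : oddprod q.+1 = oddprod q * (2 * q%:R + 1).
Proof.
case: q => [|q]; last by rewrite /oddprod big_nat_recr.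
by rewrite /oddprod !big_geq // mulr0 add0r mulr1.
Qed.

Lemma oddprod_neq0 q : oddprod q != 0.
Proof.
apply: lt0r_neq0; rewrite /oddprod; apply: prodr_gt0 => j _.
by rewrite ltr_wpDl // mulr_ge0.
Qed.

Lemma fact_double q : ((2 * q)`!)%:R = (q`!)%:R * 2 ^+ q * oddprod q.
Proof.
elim: q => [|q IH]; first by rewrite /oddprod big_geq // !mulr1.
rewrite (_ : 2 * q.+1 = (2 * q).+2)%N; last by lia.
rewrite !factS !natrM IH exprS oddprodS -[(2 * q).+2%:R]natr1 -[(2 * q).+1%:R]natr1 natrM
  -[q.+1%:R]natr1.
ring.
Qed.

Definition odd_formula (n q : nat) : rat :=
  (\prod_(0 <= j < q.+1) factor n j ^+ (4 * (q - j) + 1))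
  / (2 ^+ (2 * q * (2 * q + 1)) * \prod_(1 <= j < q.+1) (2 * j%:R + 1) ^+ (8 * (q - j) + 2)).

Definition even_formula (n q : nat) : rat :=
  (\prod_(0 <= j < q) factor n j ^+ (4 * (q - j) - 1))
  / (2 ^+ ((2 * q - 1) * (2 * q)) * \prod_(1 <= j < q) (2 * j%:R + 1) ^+ (8 * (q - j) - 2)).

(** Exponents that differ by a constant c factor out a c-th power. *)
Lemma prod_exprD (a b : nat) (F : nat -> rat) (d e : nat -> nat) (c : nat) :
  (forall j, (a <= j < b)%N -> d j = e j + c)%N ->
  \prod_(a <= j < b) F j ^+ d j = \prod_(a <= j < b) F j ^+ e j * (\prod_(a <= j < b) F j) ^+ c.
Proof.
move=> H; rewrite -prodrXl -big_split; apply: eq_big_nat => j jab.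
by rewrite H // exprD.
Qed.

Lemma factor_prodE n t : factor_prod n t = \prod_(0 <= j < t) factor n j.
Proof. by rewrite /factor_prod big_mkord. Qed.

(** From k = 2q to k = 2q + 1 the exponents of the factors with j < q grow by 2, those of the
odd numbers below 2q + 1 by 4, and the next factor and odd number come in;
  the factorials are split into powers of 2 and odd numbers by
[fact_double]. *)
Lemma odd_formula_rec n q : odd_formula n q =
  even_formula n q * (moment_norm false n q / (((2 * q)`!)%:R * ((2 * q).+1`!)%:R)).
Proof.
rewrite /odd_formula /even_formula /moment_norm !addn0.
have -> : \prod_(0 <= j < q.+1) factor n j ^+ (4 * (q - j) + 1) =
   (\prod_(0 <= j < q) factor n j ^+ (4 * (q - j) - 1)) * factor_prod n q * factor_prod n q.+1.
  rewrite big_nat_recr //= subnn expr1 [factor_prod n q.+1]factor_prodE big_nat_recr //=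
    -factor_prodE.
  rewrite (@prod_exprD _ _ _ _ (fun j => 4 * (q - j) - 1)%N 2); last by move=> j; lia.
  by rewrite -factor_prodE; ring.
have -> : \prod_(1 <= j < q.+1) (2 * j%:R + 1 : rat) ^+ (8 * (q - j) + 2) =
   (\prod_(1 <= j < q) (2 * j%:R + 1) ^+ (8 * (q - j) - 2)) * oddprod q ^+ 4 * (2 * q%:R + 1) ^+ 2.
  case: q => [|q]; first by rewrite /oddprod !big_geq // !mul1r mulr0 add0r !expr1n !mulr1.
  rewrite big_nat_recr //= subnn.
  by rewrite (@prod_exprD _ _ _ _ (fun j => 8 * (q.+1 - j) - 2)%N 4) //; move=> j; lia.
have -> : (2 * q * (2 * q + 1) = (2 * q - 1) * (2 * q) + q * 4)%N by case: q => //= q; lia.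
rewrite exprD [2 ^+ (q * 4)]exprM factS natrM fact_double -[(2 * q).+1%:R]natr1 natrM.
have o := oddprod_neq0 q; have f := fact_neq0 q.
have t : 2 ^+ q != 0 :> rat by rewrite expf_neq0.
have t' : 2 ^+ ((2 * q - 1) * (2 * q)) != 0 :> rat by rewrite expf_neq0.
have s : 2 * q%:R + 1 != 0 :> rat by rewrite lt0r_neq0 // ltr_wpDl // mulr_ge0.
have p : \prod_(1 <= j < q) (2 * j%:R + 1 : rat) ^+ (8 * (q - j) - 2) != 0.
  rewrite lt0r_neq0 // prodr_gt0 // => j _; rewrite exprn_gt0 // ltr_wpDl // mulr_ge0 //.
move: (\prod_(1 <= j < q) _) p (2 ^+ ((2 * q - 1) * (2 * q))) t' (2 ^+ q) t (oddprod q) o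
  (_`!%:R) f.
move=> p p0 t' t0' t t0 o o0 f f0.
move: (\prod_(0 <= j < q) _) (factor_prod n q) (factor_prod n q.+1) => x y z.
field.
by rewrite p0 t0' t0 o0 f0 s.
Qed.

Lemma even_formula_rec n q : even_formula n q.+1 =
  odd_formula n q * (moment_norm true n q / (((2 * q).+1`!)%:R * ((2 * q).+2`!)%:R)).
Proof.
rewrite /odd_formula /even_formula /moment_norm !addn1.
have -> : \prod_(0 <= j < q.+1) factor n j ^+ (4 * (q.+1 - j) - 1) =
   (\prod_(0 <= j < q.+1) factor n j ^+ (4 * (q - j) + 1)) * factor_prod n q.+1 * factor_prod n
     q.+1.
  rewrite (@prod_exprD _ _ _ _ (fun j => 4 * (q - j) + 1)%N 2); last by move=> j; lia.
  by rewrite -factor_prodE; ring.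
have -> : \prod_(1 <= j < q.+1) (2 * j%:R + 1 : rat) ^+ (8 * (q.+1 - j) - 2) =
   (\prod_(1 <= j < q.+1) (2 * j%:R + 1) ^+ (8 * (q - j) + 2)) * oddprod q.+1 ^+ 4.
  by rewrite (@prod_exprD _ _ _ _ (fun j => 8 * (q - j) + 2)%N 4) //; move=> j; lia.
have -> : ((2 * q.+1 - 1) * (2 * q.+1) = 2 * q * (2 * q).+1 + (q * 4 + 2))%N by lia.
have f1 : ((2 * q).+1`!)%:R = (2 * q%:R + 1) * ((q`!)%:R * 2 ^+ q * oddprod q).
  by rewrite factS natrM fact_double -natr1 natrM.
have f2 : ((2 * q).+2`!)%:R = (2 * q%:R + 2) * ((2 * q).+1`!)%:R :> rat.
  by rewrite factS natrM -[(2 * q).+2]addn2 natrD natrM.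
have f3 : (q.+1`!)%:R = (q%:R + 1) * (q`!)%:R :> rat by rewrite factS natrM -natr1.
rewrite f2 f1 f3 oddprodS exprD [2 ^+ (q * 4 + 2)]exprD [2 ^+ (q * 4)]exprM.
have o := oddprod_neq0 q; have f := fact_neq0 q.
have t : 2 ^+ q != 0 :> rat by rewrite expf_neq0.
have t' : 2 ^+ (2 * q * (2 * q).+1) != 0 :> rat by rewrite expf_neq0.
have s : 2 * q%:R + 1 != 0 :> rat by rewrite lt0r_neq0 // ltr_wpDl // mulr_ge0.
have s' : 2 * q%:R + 2 != 0 :> rat by rewrite lt0r_neq0 // ltr_wpDl // mulr_ge0.
have p : \prod_(1 <= j < q.+1) (2 * j%:R + 1 : rat) ^+ (8 * (q - j) + 2) != 0.
  rewrite lt0r_neq0 // prodr_gt0 // => j _; rewrite exprn_gt0 // ltr_wpDl // mulr_ge0 //.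
move: (\prod_(1 <= j < q.+1) _) p (2 ^+ (2 * q * (2 * q).+1)) t' (2 ^+ q) t (oddprod q) o
  (_`!%:R) f.
move=> p p0 t' t0' t t0 o o0 f f0.
move: (\prod_(0 <= j < q.+1) _) (factor_prod n q.+1) => x z.
field.
by rewrite p0 t0' t0 o0 f0 s s'.
Qed.

(** The denominator of the number of tilings of a trapezoid of height k. *)
Definition superfactorial (k : nat) : rat := \prod_(j < k) (j`!)%:R.

Lemma superfactorialS k : superfactorial k.+1 = superfactorial k * (k`!)%:R.
Proof. by rewrite /superfactorial big_ord_recr. Qed.

Lemma superfactorial_neq0 k : superfactorial k != 0.
Proof. by apply/prodf_neq0 => j _; exact: fact_neq0. Qed.

Lemma moments_formula n q :
  (\prod_(t < q.+1) moment_norm false n t) * (\prod_(t < q) moment_norm true n t) /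
    (superfactorial (2 * q).+1 * superfactorial (2 * q).+2) = odd_formula n q /\
  (\prod_(t < q) moment_norm false n t) * (\prod_(t < q) moment_norm true n t) /
    (superfactorial (2 * q) * superfactorial (2 * q).+1) = even_formula n q.
Proof.
have regroup (x y a b c d : rat) : x * y / (a * b * (c * d)) = x / (a * c) * (y / (b * d)).
  by rewrite mulf_div; congr (_ / _); ring.
have odd_step r : (\prod_(t < r.+1) moment_norm false n t) * (\prod_(t < r) moment_norm true n t) /
    (superfactorial (2 * r).+1 * superfactorial (2 * r).+2) =
  (\prod_(t < r) moment_norm false n t) * (\prod_(t < r) moment_norm true n t) /
    (superfactorial (2 * r) * superfactorial (2 * r).+1) *
    (moment_norm false n r / (((2 * r)`!)%:R * ((2 * r).+1`!)%:R)).
  by rewrite big_ord_recr /= [X in X / _]mulrAC (superfactorialS (2 * r).+1)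
    {1}(superfactorialS (2 * r)) regroup.
have even_step r : (\prod_(t < r.+1) moment_norm false n t) * (\prod_(t < r.+1) moment_norm
  true n t) /
    (superfactorial (2 * r.+1) * superfactorial (2 * r.+1).+1) =
  (\prod_(t < r.+1) moment_norm false n t) * (\prod_(t < r) moment_norm true n t) /
    (superfactorial (2 * r).+1 * superfactorial (2 * r).+2) *
    (moment_norm true n r / (((2 * r).+1`!)%:R * ((2 * r).+2`!)%:R)).
  rewrite [X in _ * X / _]big_ord_recr /= [X in X / _ = _]mulrA (_ : 2 * r.+1 = (2 * r).+2)%N;
    last by lia.
  by rewrite (superfactorialS (2 * r).+2) {1}(superfactorialS (2 * r).+1) regroup.
elim: q => [|q [IHo IHe]].
  have e0 : even_formula n 0 = 1 by rewrite /even_formula !big_geq.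
  have E : (\prod_(t < 0) moment_norm false n t) * (\prod_(t < 0) moment_norm true n t) /
    (superfactorial (2 * 0) * superfactorial (2 * 0).+1) = 1.
    by rewrite !big_ord0 /superfactorial !big_ord_recr !big_ord0.
  by rewrite odd_step odd_formula_rec E e0.
have Ee : (\prod_(t < q.+1) moment_norm false n t) * (\prod_(t < q.+1) moment_norm true n t) /
    (superfactorial (2 * q.+1) * superfactorial (2 * q.+1).+1) = even_formula n q.+1.
  by rewrite even_step IHo -even_formula_rec.
by split => //; rewrite odd_step Ee -odd_formula_rec.
Qed.

Lemma card_tilings_odd n q : (2 * q + 1 <= 2 * n)%N ->
  #|tilings (holed_hexagon n (2 * q + 1))|%:R = odd_formula n q.
Proof.
move=> qn; have [<- _] := moments_formula n q.
have E : (2 * q + 1 = q.+1 + q)%N by lia.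
have T := @tilings_moments n q.+1 q; rewrite -E in T.
rewrite -T; [|lia..].
have -> : superfactorial (2 * q).+1 * superfactorial (2 * q).+2 =
  superfactorial (2 * q + 1) * superfactorial (2 * q + 1).+1 by rewrite addn1.
by rewrite -/(superfactorial _) -/(superfactorial _) mulfK // mulf_neq0 // superfactorial_neq0.
Qed.

Lemma card_tilings_even n q : (0 < q)%N -> (2 * q <= 2 * n)%N ->
  #|tilings (holed_hexagon n (2 * q))|%:R = even_formula n q.
Proof.
move=> q0 qn; have [_ <-] := moments_formula n q.
have E : (2 * q = q + q)%N by lia.
have T := @tilings_moments n q q; rewrite -E in T.
rewrite -T; [|lia..].
by rewrite -/(superfactorial _) -/(superfactorial _) mulfK // mulf_neq0 // superfactorial_neq0.
Qed.

Theorem theorem20 (n k : nat) (hk1 : (1 <= k)%N) (hk2 : (k <= 2 * n)%N) :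
  (forall q : nat, k = (2 * q + 1)%N ->
     #|tilings (holed_hexagon n k)|%:R =
       (\prod_(0 <= i < q.+1) (n%:R - q%:R + i%:R) ^+ (4 * i + 1))
       * (\prod_(0 <= i < q.+1) (n%:R + 1 + i%:R) ^+ (4 * (q - i) + 1))
       / (2 ^+ ((2 * q) * (2 * q + 1))
          * \prod_(1 <= j < q.+1) (2 * j%:R + 1) ^+ (8 * (q - j) + 2)) :> rat
     /\
     #|tilings (holed_hexagon n k)|%:R =
       (\prod_(0 <= j < q.+1)
          ((n%:R - j%:R) * (n%:R + 1 + j%:R)) ^+ (4 * (q - j) + 1))
       / (2 ^+ (2 * q * (2 * q + 1))
          * \prod_(1 <= j < q.+1) (2 * j%:R + 1) ^+ (8 * (q - j) + 2)) :> rat)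
  /\
  (forall q : nat, k = (2 * q)%N ->
     #|tilings (holed_hexagon n k)|%:R =
       (\prod_(0 <= i < q) (n%:R - q%:R + 1 + i%:R) ^+ (4 * i + 3))
       * (\prod_(0 <= i < q) (n%:R + 1 + i%:R) ^+ (4 * (q - i) - 1))
       / (2 ^+ ((2 * q - 1) * (2 * q))
          * \prod_(1 <= j < q) (2 * j%:R + 1) ^+ (8 * (q - j) - 2)) :> rat
     /\
     #|tilings (holed_hexagon n k)|%:R =
       (\prod_(0 <= j < q)
          ((n%:R - j%:R) * (n%:R + 1 + j%:R)) ^+ (4 * (q - j) - 1))
       / (2 ^+ ((2 * q - 1) * (2 * q))
          * \prod_(1 <= j < q) (2 * j%:R + 1) ^+ (8 * (q - j) - 2)) :> rat).
Proof.
split=> q kq; rewrite kq in hk1 hk2 *.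
  rewrite card_tilings_odd //; split=> //; rewrite /odd_formula; congr (_ / _).
  under eq_bigr => j _ do rewrite /factor exprMn.
  rewrite big_split; congr (_ * _); rewrite [RHS]big_nat_rev /=; apply: eq_big_nat => i iq.
  by rewrite add0n subSS natrB //; congr (_ ^+ _); ring.
rewrite card_tilings_even //; last by lia.
split=> //; rewrite /even_formula; congr (_ / _).
under eq_bigr => j _ do rewrite /factor exprMn.
rewrite big_split; congr (_ * _); rewrite [RHS]big_nat_rev /=; apply: eq_big_nat => i iq.
rewrite add0n natrB // -[i.+1%:R]natr1 (_ : 4 * (q - i.+1) + 3 = 4 * (q - i) - 1)%N; last by lia.
by congr (_ ^+ _); ring.
Qed.
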